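(* Let $\Bbbk$ be an algebraically closed field of characteristic zero. For $n=2,3,4$, the Gelfand-Tsetlin variety for $\mathfrak{gl}_n$ is equidimensional of dimension $\frac{n(n-1)}{2}$.
   Context: Let $X_{ij}$ ($1\le i,j\le n$) be the coordinates on $\Bbbk^{n^2}$. For $1\le j\le i\le n$ let $$\overline{\gamma}_{ij}=\sum_{t_1,\ldots,t_j\in\{1,\ldots,i\}}X_{t_1t_2}X_{t_2t_3}\cdots X_{t_{j-1}t_j}X_{t_jt_1},$$ i.e. the trace of the $j$-th power of the upper left $i\times i$ submatrix of $X=(X_{ij})_{i,j=1}^n$. The Gelfand-Tsetlin variety for $\mathfrak{gl}_n$ is the common zero set $V(\{\overline{\gamma}_{ij}:1\le j\le i\le n\})\subset\Bbbk^{n^2}$. A variety (possibly reducible) is equidimensional of dimension $d$ if all its irreducible components have dimension $d$. *)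

(* Defs.v *)
From HB Require Import structures.
From mathcomp Require Import all_boot all_algebra.
From mathcomp Require Import mpoly.

Set Implicit Arguments.
Unset Strict Implicit.
Unset Printing Implicit Defensive.

Import GRing.Theory.
Local Open Scope ring_scope.

Section Zariski.

Variables (K : fieldType) (N : nat).

Definition pset := 'rV[K]_N -> Prop.
Implicit Types (V W Z A B : pset).

Definition psub Z W : Prop := forall x, Z x -> W x.

Definition pproper Z W : Prop := psub Z W /\ ~ psub W Z.

Definition zero_locus (S : {mpoly K[N]} -> Prop) : pset :=
  fun x => forall p, S p -> p.@[x ord0] = 0.

Definition zclosed Z : Prop :=
  exists S : {mpoly K[N]} -> Prop, forall x, Z x <-> zero_locus S x.

(* Irreducibility for the induced topology: the closed subsets of Z are the
   intersections of Z with closed sets of the affine space. *)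
Definition irreducible Z : Prop :=
  (exists x, Z x) /\
  forall A B, zclosed A -> zclosed B ->
    (forall x, Z x -> A x \/ B x) -> psub Z A \/ psub Z B.

Definition irr_closed_in V Z : Prop :=
  [/\ zclosed Z, irreducible Z & psub Z V].

Definition irr_component V Z : Prop :=
  irr_closed_in V Z /\ forall W, irr_closed_in V W -> psub Z W -> psub W Z.

(* C 0 < C 1 < ... < C d; the values C m with m > d are irrelevant. *)
Definition irr_chain V (d : nat) (C : nat -> pset) : Prop :=
  (forall m, (m <= d)%N -> irr_closed_in V (C m)) /\
  (forall m, (m < d)%N -> pproper (C m) (C m.+1)).

(* Krull dimension of a Zariski-closed set V. *)
Definition has_dim V (d : nat) : Prop :=
  (exists C, irr_chain V d C) /\ (forall e C, irr_chain V e C -> (e <= d)%N).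

Definition equidimensional V (d : nat) : Prop :=
  forall Z, irr_component V Z -> has_dim Z d.

End Zariski.

Section GelfandTsetlin.

Variables (K : fieldType) (n : nat).

(* The affine space of dimension n^2 is 'rV_(n * n), the (a, b) coordinate of
   a matrix sitting at position mxvec_index a b, as in mxvec. *)
Definition Xcoord (a b : 'I_n) : {mpoly K[n * n]} := 'X_(mxvec_index a b).

(* The index set {1, ..., i} is rendered as the elements of 'I_n of value < i
   (for i <= n); ordS is the cyclic successor, so that the last factor of each
   product is X_{t_j t_1}. *)
Definition gt_gamma (i j : nat) : {mpoly K[n * n]} :=
  \sum_(t : {ffun 'I_j -> 'I_n} | [forall a, (t a < i)%N])
    \prod_(a < j) Xcoord (t a) (t (ordS a)).

Definition gt_variety : pset K (n * n) :=
  zero_locus (fun p => exists i j : nat,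
    (1 <= j <= i)%N /\ (i <= n)%N /\ p = gt_gamma i j).

End GelfandTsetlin.

Arguments gt_variety : clear implicits.

(* Main.v *)
Require Import Defs.
From mathcomp Require Import all_boot all_algebra.
From mathcomp Require Import mpoly ring.
From Stdlib Require Import Classical.

(* Write X_{k+1} = [A, b; c, e] for the leading blocks.  Expanding traces of
   powers shows that in characteristic zero the equations amount to e = 0 and
   c A^l b = 0 (l < k) at every step.  On an irreducible set Z, f g = 0 forces
   f = 0 or g = 0; repeatedly splitting the equations in this way shows that a
   component Z is contained in the closure of a chart: either the matrices
   strictly triangular for some ordering of the indices, or a set where
   d = n(n-1)/2 entries are free and every other entry is a quadratic form in
   them divided by a nonzero pivot entry.  As the chart lies in the variety, Z is
   its closure.

   The closure of a chart is irreducible because any two points of the chart are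
   joined by a rational curve.  Freezing the free entries one by one gives a chain
   of length d.  There is no longer one: a chain C_0 < ... < C_e provides f_m
   vanishing on C_m but not on C_{m+1}, and f_0, ..., f_{e-1} are algebraically
   independent on C_e (divide a relation by the lowest power of f_{e-1} and
   restrict it to C_{e-1}), whereas more than d rational functions of d parameters
   with a common denominator are dependent, by counting monomials. *)

Set Implicit Arguments.
Unset Strict Implicit.
Unset Printing Implicit Defensive.

Import GRing.Theory.
Local Open Scope ring_scope.

(** * Zariski closures and charts *)

Section Closure.

Variables (K : closedFieldType) (N : nat).
Implicit Types (p q : {mpoly K[N]}) (x y z : 'rV[K]_N) (Z W T A B : pset K N).

Definition vanishes Z p : Prop := forall x, Z x -> p.@[x ord0] = 0.

Definition closure Z : pset K N := zero_locus (vanishes Z).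

Lemma sub_closure Z : psub Z (closure Z).
Proof. by move=> x Zx p; apply. Qed.

Lemma zclosed_closure Z : zclosed (closure Z).
Proof. by exists (vanishes Z). Qed.

Lemma vanishes_closure Z p : vanishes Z p -> vanishes (closure Z) p.
Proof. by move=> Zp x; apply. Qed.

Lemma closure_sub Z W : zclosed W -> psub Z W -> psub (closure Z) W.
Proof.
move=> [S WS] ZW x cZx; apply/WS => p Sp; apply: cZx => y /ZW/WS; exact.
Qed.

Lemma closureS Z W : psub Z W -> psub (closure Z) (closure W).
Proof.
by move=> ZW; apply: closure_sub (zclosed_closure W) _ => x /ZW; apply: sub_closure.
Qed.

Lemma not_sub_closed Z W : zclosed W -> ~ psub Z W ->
  exists x p, [/\ Z x, vanishes W p & p.@[x ord0] != 0].
Proof.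
move=> [S WS] nZW; apply: NNPP => nE; apply: nZW => x Zx; apply/WS => p Sp.
apply/eqP/negP => /negP px; apply: nE; exists x, p; split=> // y /WS; exact.
Qed.

(** Irreducibility applied to the hypersurfaces [p = 0] and [q = 0]; all splittings of equations on
    a component rest on this. *)
Lemma irreducibleM Z p q : irreducible Z ->
  (forall x, Z x -> p.@[x ord0] * q.@[x ord0] = 0) -> vanishes Z p \/ vanishes Z q.
Proof.
move=> [_ irrZ] Zpq.
have cl r : zclosed (fun x => r.@[x ord0] = 0).
  by exists (eq r) => x; split=> [rx _ <- //|]; apply.
by apply: irrZ => // x /Zpq /eqP; rewrite mulf_eq0 => /orP[] /eqP; [left|right].
Qed.

Lemma line_horner p x y :
  exists q : {poly K}, forall l, q.[l] = p.@[(x + l *: (y - x)) ord0].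
Proof.
exists (mmap polyC (fun i => (x 0 i)%:P + (y 0 i - x 0 i)%:P * 'X) p) => l.
rewrite /mmap horner_sum mevalE; apply: eq_bigr => m _.
rewrite hornerM hornerC /mmap1 horner_prod; congr (_ * _).
by apply: eq_bigr => i _; rewrite horner_exp !hornerE !mxE mulrC.
Qed.

Lemma has_dim_eq Z W d : psub Z W -> psub W Z -> has_dim Z d -> has_dim W d.
Proof.
move=> ZW WZ; have tr A B : psub A B -> forall e C, irr_chain A e C -> irr_chain B e C.
  move=> AB e C [hC1 hC2]; split=> // m /hC1[c i sub]; split=> // x /sub; exact: AB.
move=> [[C hC] ub]; split; first by exists C; apply: tr hC.
by move=> e C' hC'; apply: (ub e C'); apply: tr hC'.
Qed.

End Closure.

(** * Charts as graphs of rational maps *)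

Section Chart.

Variables (K : closedFieldType) (N : nat).
Implicit Types (p q : {mpoly K[N]}) (x y z : 'rV[K]_N) (T : pset K N).
Variables (G : {mpoly K[N]}) (Q : 'I_N -> {mpoly K[N]}) (s : seq 'I_N).

Definition agree_on x y : Prop := forall i, i \in s -> x 0 i = y 0 i.

Definition depends_on p : Prop :=
  forall x y, agree_on x y -> p.@[x ord0] = p.@[y ord0].

(** When [G] and the [Q i] depend only on the free coordinates, those in [s], this is the graph of
    the map with components [Q i / G] over [G != 0]. *)
Definition chart : pset K N := fun x => G.@[x ord0] != 0 /\
  forall i, i \notin s -> G.@[x ord0] * x 0 i = (Q i).@[x ord0].

Definition graph_pt z : 'rV[K]_N :=
  \row_i if i \in s then z 0 i else (Q i).@[z ord0] / G.@[z ord0].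

Hypotheses (hG : depends_on G) (hQ : forall i, i \notin s -> depends_on (Q i)).

Lemma graph_pt_agree z : agree_on (graph_pt z) z.
Proof. by move=> i si; rewrite mxE si. Qed.

Lemma graph_pt_chart z : G.@[z ord0] != 0 -> chart (graph_pt z).
Proof.
move=> Gz; rewrite /chart (hG (@graph_pt_agree z)); split=> // i si.
by rewrite (hQ si (@graph_pt_agree z)) mxE (negPf si) mulrC divfK.
Qed.

Lemma chart_graph_pt x z : chart x -> agree_on x z -> graph_pt z = x.
Proof.
move=> [Gx Ex] xz; apply/rowP => i; rewrite mxE.
case: ifPn => si; first by rewrite xz.
by rewrite -(hG xz) -(hQ si xz) -Ex // mulrC mulKf.
Qed.

(** A polynomial pulled back along the graph has only a power of [G] as denominator: true of
    constants and variables, and stable under sums and products. *)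
Lemma graph_pt_num p : exists F k, forall z, G.@[z ord0] != 0 ->
  F.@[z ord0] = G.@[z ord0] ^+ k * p.@[graph_pt z ord0].
Proof.
pose P p := exists F k, forall z, G.@[z ord0] != 0 ->
  F.@[z ord0] = G.@[z ord0] ^+ k * p.@[graph_pt z ord0].
have PM p1 p2 : P p1 -> P p2 -> P (p1 * p2).
  move=> [F1 [k1 E1]] [F2 [k2 E2]]; exists (F1 * F2), (k1 + k2)%N => z Gz.
  by rewrite !mevalM E1 // E2 // exprD; ring.
have PD p1 p2 : P p1 -> P p2 -> P (p1 + p2).
  move=> [F1 [k1 E1]] [F2 [k2 E2]].
  exists (G ^+ k2 * F1 + G ^+ k1 * F2), (k1 + k2)%N => z Gz.
  by rewrite !mevalD !mevalM !rmorphXn /= E1 // E2 // exprD; ring.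
have PC c : P c%:MP by exists c%:MP, 0%N => z _; rewrite !mevalC mul1r.
have PX i : P 'X_i.
  case si: (i \in s).
    by exists 'X_i, 0%N => z _; rewrite !mevalXU mul1r graph_pt_agree.
  exists (Q i), 1%N => z Gz.
  by rewrite mevalXU mxE si expr1 mulrC divfK.
elim/mpolyind: p => [|c m p _ _]; first by rewrite -mpolyC0; apply: PC.
apply: PD; rewrite -mul_mpolyC; apply: (PM) => //.
rewrite mpolyXE_id; apply: (big_ind P) => [|p1 p2|i _]; [by rewrite -mpolyC1 | exact: PM |].
elim: (m i) => [|k IH]; first by rewrite expr0 -[1]mpolyC1.
by rewrite exprS; apply: PM.
Qed.

(** If neither [A] nor [B] contains [T], some [p] vanishes on [A] but not at [x], and some [q]
    vanishes on [B] but not at [y]. Along the curve over the line from [x] to [y], the denominator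
    and the numerators of [p] and [q] are nonzero polynomials in the parameter; a common non-root
    gives a point of [T] outside both. A general [T] covers the chart and its slices. *)
Lemma irreducible_closure T : (exists x, T x) -> psub T chart ->
  (forall x y l, T x -> T y -> G.@[(x + l *: (y - x)) ord0] != 0 ->
     T (graph_pt (x + l *: (y - x)))) ->
  irreducible (closure T).
Proof.
move=> [x0 Tx0] Tc conn; split; first by exists x0; apply: sub_closure.
move=> A B clA clB cov; apply: NNPP => /not_or_and[nA nB].
have ntA : ~ psub T A by move=> TA; apply: nA; apply: closure_sub.
have ntB : ~ psub T B by move=> TB; apply: nB; apply: closure_sub.
have [x [p [Tx Ap px]]] := not_sub_closed clA ntA.
have [y [q [Ty Bq qy]]] := not_sub_closed clB ntB.
have [F [k EF]] := graph_pt_num p; have [H [m EH]] := graph_pt_num q.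
have [g Eg] := line_horner G x y; have [f Ef] := line_horner F x y.
have [h Eh] := line_horner H x y.
have e0 : x + 0 *: (y - x) = x by rewrite scale0r addr0.
have e1 : x + 1 *: (y - x) = y by rewrite scale1r addrC subrK.
have Gx : G.@[x ord0] != 0 by case: (Tc _ Tx).
have Gy : G.@[y ord0] != 0 by case: (Tc _ Ty).
have id_pt z : T z -> graph_pt z = z by move=> /Tc Tz; apply: chart_graph_pt.
have : g * f * h != 0.
  have nz (r : {poly K}) l : r.[l] != 0 -> r != 0.
    by apply: contraNneq => ->; rewrite horner0.
  rewrite !mulf_neq0 //.
  - by apply: (nz _ 0); rewrite Eg e0.
  - by apply: (nz _ 0); rewrite Ef e0 EF // id_pt // mulf_neq0 // expf_neq0.
  - by apply: (nz _ 1); rewrite Eh e1 EH // id_pt // mulf_neq0 // expf_neq0.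
case/closed_nonrootP => l; rewrite /root !hornerM !mulf_eq0 !negb_or.
rewrite Eg Ef Eh => /andP[/andP[gl fl] hl].
move: fl hl; rewrite EF // EH // !mulf_eq0 !negb_or => /andP[_ pl] /andP[_ ql].
case: (cov (graph_pt (x + l *: (y - x)))).
- by apply: sub_closure; apply: conn.
- by move/Ap/eqP; rewrite (negPf pl).
- by move/Bq/eqP; rewrite (negPf ql).
Qed.

Variable o : 'rV[K]_N.
Hypotheses (s_uniq : uniq s) (chart_o : chart o).

(** The first [m] free coordinates vary, the others are frozen at [o]: the slices grow from a point
    to the whole chart. *)
Definition slice m : pset K N :=
  fun x => chart x /\ forall i, i \in drop m s -> x 0 i = o 0 i.

Lemma irreducible_slice m : irreducible (closure (slice m)).
Proof.
apply: irreducible_closure => [|x []//|x y l [_ xo] [_ yo] Gz]; first by exists o.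
split=> [|i im]; first exact: graph_pt_chart.
rewrite graph_pt_agree ?(mem_drop im) // !mxE xo // yo //.
by rewrite subrr mulr0 addr0.
Qed.

Lemma chart_chain :
  irr_chain (closure chart) (size s) (fun m => closure (slice m)).
Proof.
split=> m lt_m.
  split; [exact: zclosed_closure|exact: irreducible_slice|].
  by apply: closureS => x [].
have [i0 dropE] : exists i0, drop m s = i0 :: drop m.+1 s.
  by case: s lt_m => // i t lt_m; exists (nth i (i :: t) m); apply: drop_nth.
have /andP[i0N _] : uniq (i0 :: drop m.+1 s) by rewrite -dropE drop_uniq.
have si0 : i0 \in s by apply: (@mem_drop m); rewrite dropE mem_head.
split=> [|sub].
  apply: closureS => x [cx xo]; split=> // i im; apply: xo.
  by rewrite dropE inE im orbT.
(* For strictness, move [o] along the newly freed coordinate [i0]; the factor ['X] excludes the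
   parameter 0, and [g] keeps the point off [G = 0]. *)
pose e : 'rV[K]_N := delta_mx 0 i0.
have [g Eg] := line_horner G o (o + e).
have : 'X * g != 0.
  rewrite mulf_neq0 ?polyX_eq0 //; case: chart_o => Go _.
  apply: contraNneq Go => g0.
  by rewrite -(addr0 o) -(scale0r (o + e - o)) -Eg g0 horner0.
case/closed_nonrootP => l; rewrite /root hornerM hornerX mulf_eq0 negb_or.
rewrite Eg addrAC subrr add0r; set z := o + _ => /andP[l0 Gz].
have zE i : z 0 i = o 0 i + l * (i == i0)%:R by rewrite !mxE eqxx.
have slz : slice m.+1 (graph_pt z).
  split=> [|i im]; first exact: graph_pt_chart.
  rewrite graph_pt_agree ?(mem_drop im) // zE.
  by case: eqP im => [->|_ _]; [rewrite (negPf i0N)|rewrite mulr0 addr0].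
have : vanishes (slice m) ('X_i0 - (o 0 i0)%:MP).
  move=> x [_ xo]; rewrite mevalB mevalXU mevalC xo ?subrr //.
  by rewrite dropE mem_head.
move/vanishes_closure/(_ _ (sub _ (sub_closure slz)))/eqP.
rewrite mevalB mevalXU mevalC graph_pt_agree // zE eqxx mulr1 addrC addKr.
by rewrite (negPf l0).
Qed.

End Chart.

(** * Dependence of polynomials *)

Section Dependence.

Variable K : fieldType.

Lemma card_bmultinom_le d B : (#|{: 'X_{1..d < B.+1}}| <= B.+1 ^ d)%N.
Proof.
have inj : injective (fun m : 'X_{1..d < B.+1} => [ffun i : 'I_d => inord (m i) : 'I_B.+1]).
  move=> m1 m2 /ffunP E; apply/val_inj/mnmP => i.
  have lt (m : 'X_{1..d < B.+1}) : (m i < B.+1)%N.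
    by apply: leq_trans (bmdeg m); rewrite ltnS mdegE (bigD1 i) //= leq_addr.
  by have /(congr1 val) := E i; rewrite /= !ffunE !inordK.
by have := leq_card _ inj; rewrite card_ffun !card_ord.
Qed.

Section DegreeBound.

Variable d : nat.
Implicit Types (p q : {mpoly K[d]}).

Lemma msizeM_leS p q a b :
  (msize p <= a.+1 -> msize q <= b.+1 -> msize (p * q) <= (a + b).+1)%N.
Proof.
have [->|p0] := eqVneq p 0; first by rewrite mul0r msize0.
have [->|q0] := eqVneq q 0; first by rewrite mulr0 msize0.
move=> pa qb; rewrite msizeM // -subn1 leq_subLR add1n -addSn -addnS.
exact: leq_add.
Qed.

Lemma msizeX_leS p a k : (msize p <= a.+1 -> msize (p ^+ k) <= (k * a).+1)%N.
Proof.
move=> pa; elim: k => [|k IH]; first by rewrite expr0 msize1.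
by rewrite exprS mulSn; apply: msizeM_leS.
Qed.

Lemma msize_prod_leS e (F : 'I_e -> {mpoly K[d]}) a :
  (forall i, msize (F i) <= a.+1)%N -> (msize (\prod_i F i) <= (e * a).+1)%N.
Proof.
elim: e F => [|e IH] F Fa; first by rewrite big_ord0 msize1.
by rewrite big_ord_recl mulSn; apply: msizeM_leS => //; apply: IH.
Qed.

(* [H] is meant to be a power of the common denominator of the [F i]. *)
Lemma mpoly_dependent e (F : 'I_e -> {mpoly K[d]}) (H : {mpoly K[d]}) :
  (d < e)%N -> exists D (c : {ffun 'I_e -> 'I_D.+1} -> K),
    (exists a, c a != 0) /\
    \sum_a c a *: \prod_i (F i ^+ a i * H ^+ (D - a i)) = 0.
Proof.
move=> lt_de; pose dl := (\max_i msize (F i) + msize H)%N.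
(* There are [(D + 1) ^ e] products, more than the monomials of degree at most [B]: these number at
   most [(B + 1) ^ d <= ((e * dl + 1) * (D + 1)) ^ d = D * (D + 1) ^ d < (D + 1) ^ e]. *)
pose D := ((e * dl).+1 ^ d)%N; exists D.
pose t (a : {ffun 'I_e -> 'I_D.+1}) := \prod_i (F i ^+ a i * H ^+ (D - a i)).
pose B := (e * (D * dl))%N.
have szt a : (msize (t a) <= B.+1)%N.
  apply: msize_prod_leS => i.
  have -> : (D * dl = a i * dl + (D - a i) * dl)%N.
    by rewrite -mulnDl subnKC // -ltnS.
  apply: msizeM_leS; apply: msizeX_leS; apply: leqW; last exact: leq_addl.
  by apply: leq_trans (leq_addr _ _); apply: leq_bigmax.
pose T := {ffun 'I_e -> 'I_D.+1}; pose U := 'X_{1..d < B.+1}.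
(* One row per product, one column per monomial: a nonzero row of the left kernel is the relation
   sought. *)
pose M : 'M[K]_(#|{: T}|, #|{: U}|) :=
  \matrix_(u, v) (t (enum_val u))@_(enum_val v : U).
have : ~~ row_free M.
  apply/negP => /eqP rM; have := rank_leq_col M; rewrite rM leqNgt => /negP; apply.
  apply: leq_ltn_trans (card_bmultinom_le _ _) _; rewrite card_ffun !card_ord.
  apply: (@leq_trans (D.+1 ^ d.+1)); last exact: leq_pexp2l.
  apply: (@leq_ltn_trans (((e * dl).+1 * D.+1) ^ d)%N).
    have [->//|d0] := posnP d; rewrite leq_exp2r // mulSn addnC -addn1.
    by rewrite leq_add // /B mulnCA mulnC leq_mul.
  by rewrite expnMn expnS ltn_mul2r expn_gt0 ltnSn.
rewrite -kermx_eq0 => /matrix0Pn[i [j kij]].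
exists (fun a => kermx M i (enum_rank a)); split.
  by exists (enum_val j); rewrite enum_valK.
apply/mpolyP => m; rewrite mcoeff0 raddf_sum /=.
have [lt_m|le_m] := ltnP (mdeg m) B.+1; last first.
  rewrite big1 // => a _; rewrite mcoeffZ memN_msupp_eq0 ?mulr0 //.
  by apply: msize_mdeg_ge; apply: leq_trans le_m; apply: szt.
have /matrixP/(_ i (enum_rank (BMultinom lt_m : U))) := mulmx_ker M.
rewrite !mxE => E; rewrite -[RHS]E (reindex _ (onW_bij _ (enum_val_bij T))) /=.
by apply: eq_bigr => u _; rewrite mcoeffZ !mxE enum_valK enum_rankK.
Qed.

End DegreeBound.

End Dependence.

(** * The dimension of a chart *)

(** Only finitely many indices matter, so induction replaces an axiom of choice. *)
Lemma finite_choice (T : Type) (P : nat -> T -> Prop) (t0 : T) e :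
  (forall m, (m < e)%N -> exists t, P m t) ->
  exists f, forall m, (m < e)%N -> P m (f m).
Proof.
elim: e => [|e IH] H; first by exists (fun=> t0).
have [f Hf] := IH (fun m lt_m => H m (ltnW lt_m)).
have [t Ht] := H e (ltnSn e).
exists (fun m => if m == e then t else f m) => m.
by rewrite ltnS leq_eqVlt; case: eqP => [-> //|_ /= /Hf].
Qed.

Section Independence.

Variables (K : closedFieldType) (N : nat) (Z : pset K N) (e D : nat).
Variables (C : nat -> pset K N) (f : nat -> {mpoly K[N]}).
Hypothesis chainC : irr_chain Z e C.
Hypothesis separates : forall m, (m < e)%N ->
  vanishes (C m) (f m) /\ ~ vanishes (C m.+1) (f m).

(** Independence of the first [m] functions on [C m], by induction on [m]. To keep the index type
    fixed, exponents of index at least [m] are required to be constant on the support of [c]; for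
    [m = e] this is void. *)
Lemma chain_independent_upto m (c : {ffun 'I_e -> 'I_D.+1} -> K) : (m <= e)%N ->
  (forall a b, c a != 0 -> c b != 0 -> forall i : 'I_e, (m <= i)%N -> a i = b i) ->
  (forall x, C m x ->
     \sum_a c a * \prod_(i < e | (i < m)%N) (f i).@[x ord0] ^+ a i = 0) ->
  forall a, c a = 0.
Proof.
case: chainC => irrC strictC.
elim: m c => [|m IH] c lt_me agree rel a1; apply/eqP/negP => /negP ca1.
  have [_ [[x Cx] _] _] := irrC 0%N lt_me.
  move: (rel x Cx); rewrite (bigD1 a1) //= big_pred0 // mulr1 big1 => [|a ne].
    by rewrite addr0; apply/eqP.
  suff /eqP-> : c a == 0 by rewrite mul0r.
  apply: contraNT ne => ca; apply/eqP/ffunP => i; exact: agree.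
pose im := Ordinal lt_me; have [fm nfm] := separates lt_me.
(* [a0] carries the lowest power of [f m] in the relation, and [R] is the relation divided by that
   power. *)
pose a0 := [arg min_(a < a1 | c a != 0) a im].
have [ca0 a0_min] : c a0 != 0 /\ forall a, c a != 0 -> (a0 im <= a im)%N.
  by rewrite /a0; case: arg_minnP.
pose R := \sum_a c a *: (f m ^+ (a im - a0 im) * \prod_(i < e | (i < m)%N) f i ^+ a i).
have evR (x : 'rV[K]_N) : R.@[x ord0] = \sum_a c a * ((f m).@[x ord0] ^+ (a im - a0 im) *
    \prod_(i < e | (i < m)%N) (f i).@[x ord0] ^+ a i).
  rewrite raddf_sum; apply: eq_bigr => a _ /=.
  rewrite mevalZ mevalM rmorphXn rmorph_prod; congr (_ * (_ * _)).
  by apply: eq_bigr => i _; rewrite rmorphXn.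
have factor x : C m.+1 x -> (f m ^+ a0 im).@[x ord0] * R.@[x ord0] = 0.
  move=> Cx; rewrite -[RHS](rel x Cx) evR mulr_sumr; apply: eq_bigr => a _.
  have [->|ca] := eqVneq (c a) 0; first by rewrite !mul0r mulr0.
  rewrite [in RHS](bigD1 im) //= rmorphXn /= -{2}(subnKC (a0_min a ca)) exprD.
  rewrite mulrCA -!mulrA; congr (_ * (_ * (_ * _))); apply: eq_bigl => i.
  by rewrite -(inj_eq val_inj) /= ltnS ltn_neqAle andbC.
have [_ irrCm _] := irrC m.+1 lt_me.
(* [f m] does not vanish identically on the irreducible [C m.+1], so [R] does. *)
case: (irreducibleM irrCm factor) => [fm0|R0].
  apply: nfm => x Cx; move: (fm0 x Cx); rewrite rmorphXn /= => /eqP.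
  by rewrite expf_eq0 => /andP[_ /eqP].
have [subC _] := strictC m lt_me.
(* Restricted to [C m], where [f m] is zero, [R] keeps only the terms of minimal exponent; they form
   a relation among the earlier functions. *)
suff : forall a : {ffun 'I_e -> 'I_D.+1}, (if a im == a0 im then c a else 0) = 0.
  by move/(_ a0); rewrite eqxx => /eqP; rewrite (negPf ca0).
apply: IH => [|a b|x Cx]; first exact: ltnW.
  case: (a im =P a0 im) => [ea ca|_]; last by rewrite eqxx.
  case: (b im =P a0 im) => [eb cb|_]; last by rewrite eqxx.
  move=> i; rewrite leq_eqVlt => /orP[/eqP mi|]; last exact: agree.
  have -> : i = im by apply: val_inj.
  by rewrite ea eb.
rewrite -[RHS](R0 x (subC x Cx)) evR (fm x Cx); apply: eq_bigr => a _.
have [->|ca] := eqVneq (c a) 0; first by rewrite if_same !mul0r.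
case: (a im =P a0 im) => [->|/eqP ne]; first by rewrite subnn expr0 mul1r.
rewrite mul0r expr0n subn_eq0 leqNgt ltn_neqAle a0_min // andbT eq_sym.
by rewrite (inj_eq val_inj) ne /= mul0r mulr0.
Qed.

End Independence.

Section ChartDimension.

Variables (K : closedFieldType) (N : nat).
Variables (G : {mpoly K[N]}) (Q : 'I_N -> {mpoly K[N]}) (s : seq 'I_N).
Hypotheses (hG : depends_on s G) (hQ : forall i, i \notin s -> depends_on s (Q i)).

Let d := size s.

(** Leaves [d] variables, the number that the monomial count requires. Dependent coordinates are
    sent to 0; [graph_pt] restores their values. *)
Definition free_coords : N.-tuple {mpoly K[d]} :=
  [tuple if insub (index i s) is Some j then 'X_j else 0 | i < N].

Lemma chart_chain_le e C : irr_chain (closure (chart G Q s)) e C -> (e <= d)%N.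
Proof.
move=> chainC; rewrite leqNgt; apply/negP => lt_de.
have [f sepf] : exists f, forall m, (m < e)%N ->
    vanishes (C m) (f m) /\ ~ vanishes (C m.+1) (f m).
  apply: (finite_choice (P := fun m p => vanishes (C m) p /\ ~ vanishes (C m.+1) p) 0).
  move=> m lt_me.
  have [irrC /(_ m lt_me) [_ nsub]] := chainC.
  have [clC _ _] := irrC m (ltnW lt_me).
  have [x [p [Cx Cp px]]] := not_sub_closed clC nsub.
  by exists p; split=> // /(_ x Cx)/eqP; rewrite (negPf px).
have [Fk EFk] : exists Fk : nat -> {mpoly K[N]} * nat, forall m, (m < e)%N ->
    forall z : 'rV[K]_N, G.@[z ord0] != 0 ->
    (Fk m).1.@[z ord0] = G.@[z ord0] ^+ (Fk m).2 * (f m).@[graph_pt G Q s z ord0].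
  apply: (finite_choice (P := fun m Fk => forall z : 'rV[K]_N, G.@[z ord0] != 0 -> Fk.1.@[z ord0] =
    G.@[z ord0] ^+ Fk.2 * (f m).@[graph_pt G Q s z ord0]) (0, 0%N)) => m _.
  by have [F [k E]] := graph_pt_num G Q s (f m); exists (F, k).
(* A common exponent: on the graph every [F i] becomes [G ^+ k * f i]. *)
pose k := (\sum_(i < e) (Fk i).2)%N.
have lek (i : 'I_e) : ((Fk i).2 <= k)%N by rewrite /k (bigD1 i) //= leq_addr.
pose F (i : 'I_e) := (Fk i).1 * G ^+ (k - (Fk i).2).
have [D [c [[a0 ca0] rel]]] := mpoly_dependent
  (fun i => F i \mPo free_coords) (G ^+ k \mPo free_coords) lt_de.
suff /(_ a0)/eqP : forall a, c a = 0 by rewrite (negPf ca0).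
apply: (chain_independent_upto chainC sepf (leqnn e)) => [a b _ _ i|x Cx].
  by rewrite leqNgt ltn_ord.
pose R := \sum_a c a *: \prod_(i < e) f i ^+ a i.
have -> : \sum_a c a * \prod_(i < e | (i < e)%N) (f i).@[x ord0] ^+ a i = R.@[x ord0].
  rewrite raddf_sum; apply: eq_bigr => a _ /=; rewrite mevalZ rmorph_prod.
  congr (_ * _); apply: eq_big => [i|i _]; first by rewrite ltn_ord.
  by rewrite rmorphXn.
suff chR : vanishes (chart G Q s) R.
  have [irrC _] := chainC; have [_ _ subC] := irrC e (leqnn e).
  exact: vanishes_closure chR _ (subC x Cx).
move=> y cy; pose v (j : 'I_d) := y 0 (tnth (in_tuple s) j).
pose z := \row_i (tnth free_coords i).@[v].
have evz p : (p \mPo free_coords).@[v] = p.@[z ord0].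
  by rewrite comp_mpoly_meval; apply: meval_eq => i; rewrite mxE.
have yz : agree_on s y z.
  move=> i si; rewrite mxE tnth_mktuple; have lt_i : (index i s < d)%N by rewrite index_mem.
  by rewrite insubT mevalXU /v (tnth_nth i) /= nth_index.
have Gyz := hG yz; have [Gy _] := cy.
have evF i : (F i).@[z ord0] = G.@[y ord0] ^+ k * (f i).@[y ord0].
  rewrite mevalM rmorphXn /= EFk -?Gyz // (chart_graph_pt hG hQ cy yz).
  by rewrite mulrAC -exprD subnKC.
(* Each of the [e] factors of a product contributes [G ^+ (k * D)] besides [f i ^+ a i]. *)
apply: (mulfI (expf_neq0 (k * D * e) Gy)); rewrite mulr0.
have := congr1 (meval v) rel; rewrite meval0 => <-.
rewrite !raddf_sum mulr_sumr; apply: eq_bigr => a _ /=.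
rewrite !mevalZ !rmorph_prod mulrCA /=; congr (_ * _).
rewrite -[X in (_ * _ * X)%N](card_ord e) exprM -prodr_const -big_split /=.
apply: eq_bigr => i _; rewrite mevalM !rmorphXn /= !evz evF -Gyz.
rewrite exprMn -!exprM mulrAC -exprD; congr (_ ^+ _ * _).
by rewrite -mulnDr subnKC // -ltnS.
Qed.

Lemma closure_chart_has_dim o : uniq s -> chart G Q s o ->
  irreducible (closure (chart G Q s)) /\ has_dim (closure (chart G Q s)) d.
Proof.
move=> us co; split.
  apply: (irreducible_closure hG hQ) => [|//|x y l _ _]; first by exists o.
  exact: graph_pt_chart.
split; last exact: chart_chain_le.
by exists (fun m => closure (slice G Q s o m)); apply: chart_chain.
Qed.

End ChartDimension.

(** Off [G = 0] the component lies in the chart, so by irreducibility it lies in the closure of the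
    chart. That closure is irreducible and contained in [V], so maximality gives equality. *)
Lemma component_chart_has_dim (K : closedFieldType) N (V Z : pset K N)
    (G : {mpoly K[N]}) (Q : 'I_N -> {mpoly K[N]}) (s : seq 'I_N) :
  zclosed V -> irr_component V Z -> uniq s -> depends_on s G ->
  (forall i, i \notin s -> depends_on s (Q i)) ->
  psub (chart G Q s) V -> ~ vanishes Z G ->
  (forall x, Z x -> forall i, i \notin s -> G.@[x ord0] * x 0 i = (Q i).@[x ord0]) ->
  has_dim Z (size s).
Proof.
move=> clV [[clZ irrZ ZV] maxZ] us hG hQ chV nG ZQ.
have [o cho] : exists o, chart G Q s o.
  apply: NNPP => nE; apply: nG => x Zx; apply/eqP/negP => /negP Gx.
  by apply: nE; exists x; split=> // i; apply: ZQ.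
have [irrC dimC] := closure_chart_has_dim hG hQ us cho.
have subZ : psub Z (closure (chart G Q s)).
  move=> x Zx p chp; case: (irreducibleM (p := G) (q := p) irrZ) => //.
    move=> y Zy; have [->|Gy] := eqVneq G.@[y ord0] 0; first by rewrite mul0r.
    by rewrite (chp y) ?mulr0 //; split=> // i; apply: ZQ.
  exact.
apply: has_dim_eq dimC => //; apply: maxZ => //; split=> //.
  exact: zclosed_closure.
exact: closure_sub.
Qed.

(** * The equations of the Gelfand-Tsetlin variety *)

Section CyclicSums.

Variable R : comNzRingType.
Implicit Types (X : nat -> nat -> R) (F : seq nat -> R).

Lemma foldr_sum (T : Type) (f : T -> R) r :
  foldr (fun x y => f x + y) 0 r = \sum_(x <- r) f x.
Proof. by elim: r => [|x r IH] /=; rewrite ?big_nil // big_cons IH. Qed.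

(** Nested folds, so that for numerals [i] and [j] the sum simplifies to an explicit expression that
    [ring] can treat. *)
Fixpoint seq_sum i j F : R :=
  if j is j'.+1 then foldr (fun x r => seq_sum i j' (fun u => F (x :: u)) + r) 0 (iota 0 i)
  else F [::].

Lemma sum_tuple_seq_sum n i j F : (i <= n)%N ->
  \sum_(u : j.-tuple 'I_n | all (fun x : 'I_n => (x < i)%N) u) F (map val u) = seq_sum i j F.
Proof.
move=> le_in; elim: j F => [|j IH] F /=.
  by rewrite (big_pred1 [tuple]) // => u; rewrite (tuple0 u) /= eqxx.
rewrite foldr_sum (_ : iota 0 i = index_iota 0 i) ?big_mkord; last first.
  by rewrite /index_iota subn0.
rewrite (big_ord_widen _ (fun x : nat => seq_sum i j (fun u => F (x :: u))) le_in).
under [RHS]eq_bigr => x _ do rewrite -IH.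
rewrite (pair_big (fun x : 'I_n => x < i)%N
  (fun u : j.-tuple 'I_n => all (fun x : 'I_n => (x < i)%N) u)
  (fun x u => F (val x :: map val u))) /=.
rewrite (reindex (fun p : 'I_n * j.-tuple 'I_n => cons_tuple p.1 p.2)) //=.
exists (fun u => (thead u, [tuple of behead u])) => [[x u] _|u _] /=.
  by congr pair; apply: val_inj.
by rewrite [RHS]tuple_eta; apply: val_inj.
Qed.

Fixpoint path_prod X z x u : R :=
  if u is y :: u' then X x y * path_prod X z y u' else X x z.

Definition cycle_prod X u : R := if u is x :: u' then path_prod X x x u' else 1.

Lemma cycle_prodE X u :
  \prod_(a < size u) X (nth 0%N u a) (nth 0%N u (a.+1 %% size u)) = cycle_prod X u.
Proof.
case: u => [|x u]; first by rewrite big_ord0.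
rewrite (eq_bigr (fun a : 'I_(size (x :: u)) =>
   X (nth 0%N (x :: u) a) (nth 0%N (rcons u x) a))) => [|a _]; last first.
  congr (X _ _); rewrite nth_rcons /=; have := ltn_ord a; rewrite ltnS leq_eqVlt.
  case: eqP => [->|_] /=; first by rewrite modnn ltnn.
  by move=> lt_a; rewrite modn_small // lt_a.
suff gen y : \prod_(a < (size u).+1) X (nth 0%N (y :: u) a) (nth 0%N (rcons u x) a) =
    path_prod X x y u by exact: gen.
elim: u y => [|y' u IH] y; first by rewrite big_ord1.
by rewrite [LHS]big_ord_recl [LHS]/= IH.
Qed.

End CyclicSums.

Section Coordinates.

Variables (K : closedFieldType) (m : nat).
Local Notation n := m.+1.
Implicit Type x : 'rV[K]_(n * n).

(** Indices are natural numbers, to allow numerals and pattern matching; only values below [n] are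
    meaningful. *)
Definition coord (a b : nat) : 'I_(n * n) := mxvec_index (inord a : 'I_n) (inord b : 'I_n).

Definition entry (x : 'rV[K]_(n * n)) a b : K := x 0 (coord a b).

Lemma coord_inj a b a' b' : (a < n)%N -> (b < n)%N -> (a' < n)%N -> (b' < n)%N ->
  coord a b = coord a' b' -> (a, b) = (a', b').
Proof.
move=> lta ltb lta' ltb' E; have := onT_bij (curry_mxvec_bij n n).
move/bij_inj/(_ (_, _) (_, _) E) => [/(congr1 val) /= Ea /(congr1 val) /= Eb].
by move: Ea Eb; rewrite !inordK // => -> ->.
Qed.

Lemma coordP (i : 'I_(n * n)) : exists a b, [/\ (a < n)%N, (b < n)%N & i = coord a b].
Proof.
by case/mxvec_indexP: i => a b; exists a, b; rewrite /coord !inord_val; split.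
Qed.

Lemma gt_gamma_eval x i j : (i <= n)%N ->
  (gt_gamma K n i j).@[x ord0] = seq_sum i j (cycle_prod (entry x)).
Proof.
move=> le_in; rewrite -(sum_tuple_seq_sum _ _ le_in) raddf_sum /=.
rewrite (reindex (fun u : j.-tuple 'I_n => [ffun a => tnth u a])) /=; last first.
  exists (fun t => [tuple t a | a < j]) => [u _|t _].
    by apply: eq_from_tnth => a; rewrite tnth_mktuple ffunE.
  by apply/ffunP => a; rewrite ffunE tnth_mktuple.
apply: eq_big => [u|u _].
  apply/forallP/all_tnthP => H a; move: (H a); by rewrite ffunE.
rewrite rmorph_prod -cycle_prodE size_map size_tuple; apply: eq_bigr => a _ /=.
rewrite mevalXU !ffunE /entry /coord !(nth_map ord0) ?size_tuple ?ltn_mod //; last first.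
  exact: leq_trans (ltn_ord a).
by rewrite !inord_val !(tnth_nth ord0).
Qed.

Lemma gt_varietyE x : gt_variety K n x <->
  forall i j, (0 < j <= i)%N -> (i <= n)%N -> seq_sum i j (cycle_prod (entry x)) = 0.
Proof.
split=> [H i j|H p].
  by move=> le_ji le_in; rewrite -gt_gamma_eval //; apply: H; exists i, j.
by move=> [i [j [le_ji [le_in ->]]]]; rewrite gt_gamma_eval // H.
Qed.

End Coordinates.

Section Equations.

Variable K : closedFieldType.
Implicit Type X : nat -> nat -> K.

Definition gt_eqs2 X := [/\ X 0 0 = 0, X 1 1 = 0 & X 0 1 * X 1 0 = 0].

(** With A the leading 2 x 2 block (of zero diagonal), b the last column and c the last row, the
    last two equations are c b = c A b = 0. *)
Definition gt_eqs3 X := [/\ gt_eqs2 X, X 2 2 = 0,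
  X 2 0 * X 0 2 + X 2 1 * X 1 2 = 0 &
  X 2 0 * X 0 1 * X 1 2 + X 2 1 * X 1 0 * X 0 2 = 0].

(* With A the leading 3 x 3 block (of zero diagonal), p the last column and q the
   last row: q p = q A p = q A^2 p = 0. *)
Definition last_eqs4 X := [/\ X 3 3 = 0,
  X 3 0 * X 0 3 + X 3 1 * X 1 3 + X 3 2 * X 2 3 = 0,
  X 3 0 * (X 0 1 * X 1 3 + X 0 2 * X 2 3) + X 3 1 * (X 1 0 * X 0 3 + X 1 2 * X 2 3) +
    X 3 2 * (X 2 0 * X 0 3 + X 2 1 * X 1 3) = 0 &
  (X 3 1 * X 1 0 + X 3 2 * X 2 0) * (X 0 1 * X 1 3 + X 0 2 * X 2 3) +
  (X 3 0 * X 0 1 + X 3 2 * X 2 1) * (X 1 0 * X 0 3 + X 1 2 * X 2 3) +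
  (X 3 0 * X 0 2 + X 3 1 * X 1 2) * (X 2 0 * X 0 3 + X 2 1 * X 1 3) = 0].

Definition gt_eqs4 X := gt_eqs3 X /\ last_eqs4 X.

Hypothesis charK : [pchar K] =i pred0.

Let natr_neq0 k : k.+1%:R != 0 :> K.
Proof. by have /pcharf0P -> := charK. Qed.

Definition power_sums n X := forall i j, (0 < j <= i)%N -> (i <= n)%N ->
  seq_sum i j (cycle_prod X) = 0.

Lemma power_sumsS n X : power_sums n.+1 X <->
  power_sums n X /\ forall j, (0 < j <= n.+1)%N -> seq_sum n.+1 j (cycle_prod X) = 0.
Proof.
split=> [H|[H1 H2] i j ji]; first by split=> [i j ji /leqW|j jn]; apply: H.
by rewrite leq_eqVlt => /orP[/eqP E|]; [move: ji; rewrite E; apply: H2|apply: H1].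
Qed.

Let natr_mul_eq0 k (a b : K) : a = k.+1%:R * b -> a = 0 -> b = 0.
Proof. by move=> -> /eqP; rewrite mulf_eq0 (negPf (natr_neq0 k)) => /eqP. Qed.

Lemma power_sums2 X : power_sums 2 X <-> gt_eqs2 X.
Proof.
have s22 : X 0 0 = 0 -> X 1 1 = 0 ->
    seq_sum 2 2 (cycle_prod X) = 2%:R * (X 0 1 * X 1 0).
  by move=> e0 e1; rewrite /= e0 e1; ring.
split=> [H|[e0 e1 e01]].
  have e0 : X 0 0 = 0 by rewrite -[RHS](H 1 1)%N //=; ring.
  have e1 : X 1 1 = 0 by rewrite -[RHS](H 2 1)%N //= e0; ring.
  by split=> //; apply: natr_mul_eq0 (s22 e0 e1) (H 2 2 _ _)%N.
move=> [|[|[|i]]] [|[|[|j]]] // _ _; last by rewrite s22 // e01; ring.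
all: by rewrite /= e0 ?e1; ring.
Qed.

Lemma power_sums3 X : power_sums 3 X <-> gt_eqs3 X.
Proof.
rewrite power_sumsS power_sums2 /gt_eqs3; set f2 := _ + _; set f3 := _ + _.
have s32 : X 0 0 = 0 -> X 1 1 = 0 -> X 2 2 = 0 ->
    seq_sum 3 2 (cycle_prod X) = 2%:R * (X 0 1 * X 1 0 + f2).
  by move=> e0 e1 e2; rewrite /= e0 e1 e2 /f2; ring.
have s33 : X 0 0 = 0 -> X 1 1 = 0 -> X 2 2 = 0 ->
    seq_sum 3 3 (cycle_prod X) = 3%:R * f3.
  by move=> e0 e1 e2; rewrite /= e0 e1 e2 /f3; ring.
split=> [[E2 H]|[E2 e2 h2 h3]]; have [e0 e1 e01] := E2.
  have e2 : X 2 2 = 0 by rewrite -[RHS](H 1%N) //= e0 e1; ring.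
  split=> //; last exact: natr_mul_eq0 (s33 e0 e1 e2) (H 3 isT).
  by have := natr_mul_eq0 (s32 e0 e1 e2) (H 2 isT); rewrite e01 add0r.
split=> // -[|[|[|[|j]]]] // _; first by rewrite /= e0 e1 e2; ring.
  by rewrite s32 // e01 h2; ring.
by rewrite s33 // h3 mulr0.
Qed.

(** Once the diagonal is zero, closed walks through the last index add 2 q p, 3 q A p and 4 q A^2 p
    + 2 (q p)^2 to the traces of the powers of A. Characteristic zero lets the numerical factors be
    cancelled. *)
Lemma power_sums4 X : power_sums 4 X <-> gt_eqs4 X.
Proof.
rewrite power_sumsS power_sums3 /gt_eqs4 /last_eqs4.
set g2 := _ + _; set g3 := _ + _; set g4 := _ + _.
pose f2 := X 2 0 * X 0 2 + X 2 1 * X 1 2.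
pose f3 := X 2 0 * X 0 1 * X 1 2 + X 2 1 * X 1 0 * X 0 2.
pose diag0 := [/\ X 0 0 = 0, X 1 1 = 0, X 2 2 = 0 & X 3 3 = 0].
have s42 : diag0 -> seq_sum 4 2 (cycle_prod X) = 2%:R * (X 0 1 * X 1 0 + f2 + g2).
  by case=> e0 e1 e2 e3; rewrite /= e0 e1 e2 e3 /f2 /g2; ring.
have s43 : diag0 -> seq_sum 4 3 (cycle_prod X) = 3%:R * (f3 + g3).
  by case=> e0 e1 e2 e3; rewrite /= e0 e1 e2 e3 /f3 /g3; ring.
(* The last square is the trace of A^4: by Cayley-Hamilton for a traceless 3 x 3 block it is twice
   the square of half the trace of A^2. *)
have s44 : diag0 -> seq_sum 4 4 (cycle_prod X) =
    4%:R * g4 + 2%:R * g2 ^+ 2 + 2%:R * (X 0 1 * X 1 0 + f2) ^+ 2.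
  by case=> e0 e1 e2 e3; rewrite /= e0 e1 e2 e3 /f2 /g2 /g4; ring.
split=> [[E3 H]|[E3 [e3 h2 h3 h4]]]; have [[e0 e1 e01] e2 k2 k3] := E3.
  have e3 : X 3 3 = 0 by rewrite -[RHS](H 1%N) //= e0 e1 e2; ring.
  have d0 : diag0 by [].
  have h2 : g2 = 0.
    by have := natr_mul_eq0 (s42 d0) (H 2 isT); rewrite e01 /f2 k2 !add0r.
  split=> //; split=> //.
    by have := natr_mul_eq0 (s43 d0) (H 3 isT); rewrite /f3 k3 add0r.
  apply: natr_mul_eq0 (H 4 isT); rewrite s44 // e01 /f2 k2 h2.
  by rewrite addr0 expr0n mulr0 !addr0.
have d0 : diag0 by [].
split=> // -[|[|[|[|[|j]]]]] // _; first by rewrite /= e0 e1 e2 e3; ring.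
- by rewrite s42 // e01 /f2 k2 h2; ring.
- by rewrite s43 // /f3 k3 h3; ring.
- by rewrite s44 // e01 /f2 k2 h2 h4; ring.
Qed.

End Equations.

(** * Quadratic charts in the entries of a matrix *)

Definition position := (nat * nat)%type.

(* A quadratic form in the entries: a list of signed products, [true] standing
   for the sign [-]. *)
Definition qform := seq (bool * (position * position)).

(** An unlisted position gets the empty form, of value 0, so its entry vanishes on the chart if it
    is not free. *)
Definition lookup (deps : seq (position * qform)) u : qform :=
  foldr (fun d r => if d.1 == u then d.2 else r) [::] deps.

Section QuadraticCharts.

Variables (K : closedFieldType) (N n : nat).
Implicit Types (x : 'rV[K]_N) (Z V : pset K N) (X : nat -> nat -> K).
Implicit Types (s : seq position) (g : option position) (deps : seq (position * qform)).

Definition qeval X (q : qform) : K := foldr (fun t r =>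
  (if t.1 then - (X t.2.1.1 t.2.1.2 * X t.2.2.1 t.2.2.2)
   else X t.2.1.1 t.2.1.2 * X t.2.2.1 t.2.2.2) + r) 0 q.

(** [None] is the constant pivot 1, used for coordinate subspaces. *)
Definition pivot g X : K := if g is Some u then X u.1 u.2 else 1.

(* The entries outside [s] are determined by those in [s], rationally, with the
   pivot as denominator. *)
Definition chart_rel s g deps X : Prop := forall a b, (a < n)%N -> (b < n)%N ->
  (a, b) \notin s -> pivot g X * X a b = qeval X (lookup deps (a, b)).

Lemma chart_rel_eq0 s g deps X a b : pivot g X != 0 -> chart_rel s g deps X ->
  (a < n)%N -> (b < n)%N -> (a, b) \notin s -> lookup deps (a, b) == [::] -> X a b = 0.
Proof.
move=> g0 H la lb nab /eqP E; have := H a b la lb nab.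
by rewrite E => /eqP; rewrite mulf_eq0 (negPf g0) => /eqP.
Qed.

(** Symmetries of the problem act on [ix] alone, leaving [V] and [Z] unchanged. *)
Definition reindexing (ix : nat -> nat -> 'I_N) : Prop :=
  (forall a b a' b', (a < n)%N -> (b < n)%N -> (a' < n)%N -> (b' < n)%N ->
     ix a b = ix a' b' -> (a, b) = (a', b')) /\
  forall i, exists a b, [/\ (a < n)%N, (b < n)%N & i = ix a b].

Variable ix : nat -> nat -> 'I_N.
Hypothesis ixP : reindexing ix.

Local Notation entries x := (fun a b => x 0 (ix a b)).

Definition ipoly (u : position) : {mpoly K[N]} := 'X_(ix u.1 u.2).

Definition qpoly (q : qform) : {mpoly K[N]} := foldr (fun t r =>
  (if t.1 then - (ipoly t.2.1 * ipoly t.2.2) else ipoly t.2.1 * ipoly t.2.2) + r) 0 q.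

Lemma qpolyE x q : (qpoly q).@[x ord0] = qeval (entries x) q.
Proof.
elim: q => [|[[] [u v]] q IH] /=; rewrite ?meval0 // mevalD IH ?mevalN mevalM !mevalXU //.
Qed.

Definition variables_in s (q : qform) := all (fun t => (t.2.1 \in s) && (t.2.2 \in s)) q.

Lemma lookup_variables s deps u :
  all (fun d => variables_in s d.2) deps -> variables_in s (lookup deps u).
Proof. by elim: deps => //= d deps IH /andP[hd /IH]; case: ifP. Qed.

Lemma pivot_chart_has_dim V Z s g deps :
  zclosed V -> irr_component V Z -> uniq s ->
  all (fun u => (u.1 < n)%N && (u.2 < n)%N) s ->
  (if g is Some u then u \in s else true) ->
  all (fun d => variables_in s d.2) deps ->
  (forall x, pivot g (entries x) != 0 -> chart_rel s g deps (entries x) -> V x) ->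
  ~ (forall x, Z x -> pivot g (entries x) = 0) ->
  (forall x, Z x -> chart_rel s g deps (entries x)) ->
  has_dim Z (size s).
Proof.
move=> clV compZ us lts gs depsP chV nZ ZQ.
have [ix_inj ix_surj] := ixP.
pose G : {mpoly K[N]} := if g is Some u then ipoly u else 1.
have GE x : G.@[x ord0] = pivot g (entries x).
  by rewrite /G; case: (g) => [u|] /=; rewrite ?mevalXU ?meval1.
pose S := [seq ix u.1 u.2 | u <- s].
(* [Q] is indexed by coordinates but [deps] by positions; [xchoose] inverts [ix]. *)
have dec (i : 'I_N) : exists u : position,
    [&& (u.1 < n)%N, (u.2 < n)%N & i == ix u.1 u.2].
  by have [a [b [la lb ->]]] := ix_surj i; exists (a, b); rewrite /= la lb eqxx.
pose Q i := qpoly (lookup deps (xchoose (dec i))).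
have ix_inj_in : {in [pred u : position | (u.1 < n)%N && (u.2 < n)%N] &,
    injective (fun u : position => ix u.1 u.2)}.
  by move=> [a b] [a' b'] /andP[? ?] /andP[? ?] /= /ix_inj; apply.
have memS a b : (a < n)%N -> (b < n)%N -> (ix a b \in S) = ((a, b) \in s).
  move=> la lb; apply/mapP/idP => [[u us' E]|abs]; last by exists (a, b).
  have /andP[? ?] := allP lts u us'.
  by rewrite (ix_inj_in (a, b) u) ?inE ?la //; apply/andP.
have QE x a b : (a < n)%N -> (b < n)%N ->
    (Q (ix a b)).@[x ord0] = qeval (entries x) (lookup deps (a, b)).
  move=> la lb; rewrite qpolyE; congr (qeval _ (lookup _ _)).
  case: (xchoose _) (xchooseP (dec (ix a b))) => a' b' /= /and3P[la' lb' /eqP E].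
  by rewrite (ix_inj _ _ _ _ la lb la' lb' E).
have relE x : (forall i, i \notin S -> G.@[x ord0] * x 0 i = (Q i).@[x ord0]) <->
    chart_rel s g deps (entries x).
  split=> H => [a b la lb nab|i].
    by rewrite -QE // -GE; apply: H; rewrite memS.
  have [a [b [la lb ->]]] := ix_surj i.
  by rewrite memS // => nab; rewrite QE // GE; apply: H.
rewrite -(size_map (fun u => ix u.1 u.2) s) -/S.
have agreeE x y u : agree_on S x y -> u \in s -> x 0 (ix u.1 u.2) = y 0 (ix u.1 u.2).
  by move=> xy us'; apply: xy; apply: map_f.
apply: (component_chart_has_dim (G := G) (Q := Q) clV compZ).
- by rewrite map_inj_in_uniq // => u v /(allP lts) us' /(allP lts) vs'; apply: ix_inj_in.
- by move=> x y xy; rewrite !GE; case: (g) gs => //= u; apply: agreeE.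
- move=> i _ x y xy; rewrite !qpolyE.
  have := lookup_variables (xchoose (dec i)) depsP.
  elim: (lookup _ _) => //= t q IH /andP[/andP[t1 t2] /IH ->].
  by rewrite !(agreeE x y).
- by move=> x [Gx /relE]; apply: chV; rewrite -GE.
- by move=> G0; apply: nZ => x Zx; rewrite -GE; apply: G0.
- by move=> x Zx; apply/relE/ZQ.
Qed.

Lemma linear_chart_has_dim V Z s : zclosed V -> irr_component V Z -> uniq s ->
  all (fun u => (u.1 < n)%N && (u.2 < n)%N) s ->
  (forall x, (forall a b, (a < n)%N -> (b < n)%N -> (a, b) \notin s -> x 0 (ix a b) = 0) ->
     V x) ->
  (forall x, Z x -> forall a b, (a < n)%N -> (b < n)%N -> (a, b) \notin s ->
     x 0 (ix a b) = 0) ->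
  has_dim Z (size s).
Proof.
move=> clV compZ us lts sV ZP.
apply: (pivot_chart_has_dim (g := None) (deps := [::]) clV compZ) => //=.
- by move=> x _ H; apply: sV => a b la lb nab; have := H a b la lb nab; rewrite /= mul1r.
- have [[_ [[x0 Zx0] _] _] _] := compZ.
  by move/(_ x0 Zx0)/eqP; rewrite oner_eq0.
- by move=> x Zx a b la lb nab; rewrite /= mul1r ZP.
Qed.

End QuadraticCharts.

(** * Symmetries of the positions and of the equations *)

Definition permute T (l : seq nat) (Y : nat -> nat -> T) a b := Y (nth 0%N l a) (nth 0%N l b).

Definition transpose T (Y : nat -> nat -> T) a b := Y b a.

Section Reindexing.

Variables (N n : nat) (ix : nat -> nat -> 'I_N).
Hypothesis ixP : reindexing n ix.

Lemma reindexing_tr : reindexing n (transpose ix).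
Proof.
have [inj surj] := ixP; split=> [a b a' b' la lb la' lb' E|i].
  by have [-> ->] := inj _ _ _ _ lb la lb' la' E.
by have [a [b [la lb ->]]] := surj i; exists b, a.
Qed.

Lemma reindexing_perm l : perm_eq l (iota 0 n) ->
  reindexing n (permute l ix).
Proof.
move=> pl; have [inj surj] := ixP.
have sl : size l = n by rewrite (perm_size pl) size_iota.
have ul : uniq l by rewrite (perm_uniq pl) iota_uniq.
have ml a : (a \in l) = (a < n)%N by rewrite (perm_mem pl) mem_iota.
have lt a : (a < n)%N -> (nth 0%N l a < n)%N by move=> la; rewrite -ml mem_nth ?sl.
split=> [a b a' b' la lb la' lb' E|i].
  have [/eqP Ea /eqP Eb] := inj _ _ _ _ (lt a la) (lt b lb) (lt a' la') (lt b' lb') E.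
  by move: Ea Eb; rewrite !nth_uniq ?sl // => /eqP -> /eqP ->.
have [a [b [la lb ->]]] := surj i.
by exists (index a l), (index b l); rewrite /permute -{1 2}sl !index_mem !nth_index !ml.
Qed.

End Reindexing.

Section Patterns.

Variable K : closedFieldType.
Implicit Type Y : nat -> nat -> K.

Definition strict_upper3 Y :=
  [/\ [/\ Y 0 0 = 0, Y 1 1 = 0 & Y 2 2 = 0], Y 1 0 = 0, Y 2 0 = 0 & Y 2 1 = 0].

Definition last_column3 Y := strict_upper3 Y /\ Y 0 1 = 0.

Definition quadric3 Y :=
  [/\ [/\ Y 0 0 = 0, Y 1 1 = 0 & Y 2 2 = 0], Y 0 1 = 0, Y 1 0 = 0 &
      Y 2 0 * Y 0 2 + Y 2 1 * Y 1 2 = 0].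

(** The last index stays fixed, so these permutations conjugate A and reorder p and q
    accordingly. *)
Definition perms3 : seq (seq nat) := [:: [:: 0; 1; 2; 3]; [:: 0; 2; 1; 3];
  [:: 1; 0; 2; 3]; [:: 1; 2; 0; 3]; [:: 2; 0; 1; 3]; [:: 2; 1; 0; 3]]%N.

(** Transposition exchanges p with q and A with its transpose, which preserves each q A^l p. *)
Lemma last_eqs4_tr Y : last_eqs4 (transpose Y) <-> last_eqs4 Y.
Proof.
by split; move=> [e g2 g3 g4]; rewrite /transpose in e g2 g3 g4 *;
  (split; [done|rewrite -[RHS]g2|rewrite -[RHS]g3|rewrite -[RHS]g4]); ring.
Qed.

Lemma last_eqs4_perm l Y : l \in perms3 -> last_eqs4 (permute l Y) <-> last_eqs4 Y.
Proof.
rewrite !inE => /or4P[||| /or3P[]] /eqP->; rewrite /last_eqs4 /permute /=;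
  by split; move=> [e g2 g3 g4];
  (split; [done|rewrite -[RHS]g2|rewrite -[RHS]g3|rewrite -[RHS]g4]); ring.
Qed.

Lemma strict_upper3_eqs l Y : l \in perms3 -> strict_upper3 (permute l Y) -> gt_eqs3 Y.
Proof.
rewrite !inE => /or4P[||| /or3P[]] /eqP->;
  move=> [[/= z00 z11 z22] z10 z20 z21]; rewrite /permute /= in z00 z11 z22 z10 z20 z21;
  by split=> //; [split=> //|..]; ring: z10 z20 z21.
Qed.

Lemma quadric3_eqs Y : quadric3 Y -> gt_eqs3 Y.
Proof. by move=> [[z00 z11 z22] z01 z10 f2]; split=> //; [split=> //|]; ring: z01 z10. Qed.

End Patterns.

(** * Splitting equations on a component *)

Section Component.

Variables (K : closedFieldType) (N : nat) (V Z : pset K N).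
Implicit Types (x : 'rV[K]_N) (X : nat -> nat -> K) (f g : 'rV[K]_N -> K).
Hypotheses (clV : zclosed V) (compZ : irr_component V Z).

Definition regular f : Prop := exists p : {mpoly K[N]}, forall x, p.@[x ord0] = f x.

Lemma regularX i : regular (fun x => x 0 i).
Proof. by exists 'X_i => x; rewrite mevalXU. Qed.

Lemma regularD f g : regular f -> regular g -> regular (fun x => f x + g x).
Proof. by move=> [p pE] [q qE]; exists (p + q) => x; rewrite mevalD pE qE. Qed.

Lemma regularN f : regular f -> regular (fun x => - f x).
Proof. by move=> [p pE]; exists (- p) => x; rewrite mevalN pE. Qed.

Lemma regularM f g : regular f -> regular g -> regular (fun x => f x * g x).
Proof. by move=> [p pE] [q qE]; exists (p * q) => x; rewrite mevalM pE qE. Qed.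

Definition zero_on f : Prop := forall x, Z x -> f x = 0.

Lemma zero_onM f g : regular f -> regular g ->
  zero_on (fun x => f x * g x) -> zero_on f \/ zero_on g.
Proof.
move=> [p pE] [q qE] fg0; have [[_ irrZ _] _] := compZ.
case: (irreducibleM (p := p) (q := q) irrZ) => [x Zx|p0|q0].
- by rewrite pE qE; apply: fg0.
- by left=> x Zx; rewrite -pE; apply: p0.
- by right=> x Zx; rewrite -qE; apply: q0.
Qed.

(** [C] stands for a condition on the leading block that takes care of its own equations. This is
    the half of a case that places charts inside [V]; [holds_on] is the half about [Z]. *)
Definition admissible4 (ix : nat -> nat -> 'I_N) (C : (nat -> nat -> K) -> Prop) : Prop :=
  reindexing 4 ix /\ forall x, C (fun a b => x 0 (ix a b)) ->
    last_eqs4 (fun a b => x 0 (ix a b)) -> V x.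

End Component.

(** * Case analysis on a component *)

(** Runs through the 16 positions and discards the free ones. *)
Ltac entry_cases4 := let H := fresh in
  move=> [|[|[|[|?]]]] [|[|[|[|?]]]] // _ _ H; (try by move: H); clear H; rewrite /=.

Section Components4.

Variables (K : closedFieldType) (N : nat) (V Z : pset K N).
Hypotheses (clV : zclosed V) (compZ : irr_component V Z).
Implicit Types (ix : nat -> nat -> 'I_N) (Y : nat -> nat -> K) (C : (nat -> nat -> K) -> Prop).

Local Notation entries ix x := (fun a b : nat => x 0 (ix a b)).
Local Notation entry0 ix a b := (zero_on Z (fun x : 'rV[K]_N => x 0 (ix a b))).

Definition holds_on ix C : Prop := forall x, Z x -> C (entries ix x) /\ last_eqs4 (entries ix x).

Lemma linear_has_dim ix C (s : seq position) : admissible4 V ix C ->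
  uniq s -> all (fun u => (u.1 < 4)%N && (u.2 < 4)%N) s ->
  (forall Y, (forall a b, (a < 4)%N -> (b < 4)%N -> (a, b) \notin s -> Y a b = 0) ->
     C Y /\ last_eqs4 Y) ->
  (forall x, Z x -> forall a b, (a < 4)%N -> (b < 4)%N -> (a, b) \notin s ->
     x 0 (ix a b) = 0) ->
  has_dim Z (size s).
Proof.
move=> [ixP VP] us lts sP ZP; apply: (linear_chart_has_dim ixP clV compZ) => // x x0.
have [|c lst] := sP (entries ix x); last exact: VP.
exact: x0.
Qed.

(* In the notation of [last_eqs4] the block A is the single column u, so that
   q A p = (q . u) p_2: either p_2 = 0 (type I) or q . u = 0 (type II). *)
Lemma typeI_has_dim ix : admissible4 V ix (@last_column3 K) ->
  holds_on ix (@last_column3 K) -> entry0 ix 2 3 -> ~ entry0 ix 0 3 -> has_dim Z 6.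
Proof.
move=> [ixP VP] colZ p2 p0.
apply: (pivot_chart_has_dim (s := [:: (0,2); (1,2); (3,2); (0,3); (1,3); (3,1)]%N)
  (g := Some (0,3)%N) (deps := [:: ((3,0), [:: (true, ((1,3), (3,1)))])]%N) ixP clV compZ) => //.
- move=> x g0 H; have z a b := chart_rel_eq0 (a := a) (b := b) g0 H.
  have := H 3%N 0%N isT isT isT; rewrite /= addr0 => e30.
  have [z10 z20 z21] : [/\ entries ix x 1 0 = 0, entries ix x 2 0 = 0 & entries ix x 2 1 = 0].
    by split; apply: z.
  have [z01 z23 z33] : [/\ entries ix x 0 1 = 0, entries ix x 2 3 = 0 & entries ix x 3 3 = 0].
    by split; apply: z.
  apply: VP; first by split=> //; split=> //; split; apply: z.
  by split=> //; ring: e30 z10 z20 z21 z01 z23.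
- move=> x Zx; have [[[[z00 z11 z22] z10 z20 z21] z01] [z33 g2 g3 g4]] := colZ x Zx.
  have z23 := p2 x Zx; entry_cases4; try by ring: z00 z11 z22 z10 z20 z21 z01 z33 z23.
  by apply/subr0_eq; rewrite -[RHS]g2; ring: z23.
Qed.

(** With pivot q_0, the equations q . u = 0 and q p = 0 are solved for u_0 and p_0; then q A p = 0,
    and q A^2 p = 0 because A^2 = 0. *)
Lemma typeII_has_dim ix : admissible4 V ix (@last_column3 K) ->
  holds_on ix (@last_column3 K) ->
  zero_on Z (fun x => x 0 (ix 3 0) * x 0 (ix 0 2) + x 0 (ix 3 1) * x 0 (ix 1 2)) ->
  ~ entry0 ix 3 0 -> has_dim Z 6.
Proof.
move=> [ixP VP] colZ qu q0.
apply: (pivot_chart_has_dim (s := [:: (3,0); (3,1); (3,2); (1,2); (1,3); (2,3)]%N)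
  (g := Some (3,0)%N) (deps := [:: ((0,2), [:: (true, ((3,1), (1,2)))]);
    ((0,3), [:: (true, ((3,1), (1,3))); (true, ((3,2), (2,3)))])]%N) ixP clV compZ) => //.
- move=> x g0 H; have z a b := chart_rel_eq0 (a := a) (b := b) g0 H.
  have := H 0%N 2%N isT isT isT; rewrite /= addr0 => e02.
  have := H 0%N 3%N isT isT isT; rewrite /= addr0 => e03.
  have [z10 z20 z21] : [/\ entries ix x 1 0 = 0, entries ix x 2 0 = 0 & entries ix x 2 1 = 0].
    by split; apply: z.
  have [z01 z33] : entries ix x 0 1 = 0 /\ entries ix x 3 3 = 0 by split; apply: z.
  apply: VP; first by split=> //; split=> //; split; apply: z.
  by split=> //; [ring: e03|ring: e02 z10 z20 z21 z01|ring: z10 z20 z21 z01 e02].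
- move=> x Zx; have [[[[z00 z11 z22] z10 z20 z21] z01] [z33 g2 g3 g4]] := colZ x Zx.
  have qux := qu x Zx; entry_cases4; try by ring: z00 z11 z22 z10 z20 z21 z01 z33.
    by apply/subr0_eq; rewrite -[RHS]qux; ring.
  by apply/subr0_eq; rewrite -[RHS]g2; ring.
Qed.

Lemma holds_on_perm ix C D l : l \in perms3 -> (forall Y, C Y -> D (permute l Y)) ->
  holds_on ix C -> holds_on (permute l ix) D.
Proof.
move=> pl CD H x /H[c e]; split; first exact: (CD (entries ix x)).
exact/(last_eqs4_perm (entries ix x) pl).
Qed.

Lemma holds_on_tr ix C D : (forall Y, C Y -> D (transpose Y)) ->
  holds_on ix C -> holds_on (transpose ix) D.
Proof.
move=> CD H x /H[c e]; split; first exact: (CD (entries ix x)).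
exact/(last_eqs4_tr (entries ix x)).
Qed.

Lemma admissible4_perm ix C D l : l \in perms3 -> (forall Y, D (permute l Y) -> C Y) ->
  admissible4 V ix C -> admissible4 V (permute l ix) D.
Proof.
move=> pl DC [ixP H]; split.
  by apply: (reindexing_perm ixP); move: pl; rewrite !inE => /or4P[||| /or3P[]] /eqP->.
by move=> x /(DC (entries ix x)) c /(last_eqs4_perm (entries ix x) pl); apply: H.
Qed.

Lemma admissible4_tr ix C D : (forall Y, D (transpose Y) -> C Y) ->
  admissible4 V ix C -> admissible4 V (transpose ix) D.
Proof.
move=> DC [ixP H]; split; first exact: reindexing_tr.
by move=> x /(DC (entries ix x)) c /(last_eqs4_tr (entries ix x)); apply: H.
Qed.

Lemma last_column3_swap Y : last_column3 (permute [:: 1; 0; 2; 3]%N Y) <-> last_column3 Y.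
Proof. by split=> [] [[[? ? ?] ? ? ?] ?]. Qed.

(** The positions above the diagonal once the indices are listed in the order [l]. *)
Definition order_pairs (l : seq nat) : seq position :=
  let i := nth 0%N l in
  [:: (i 0, i 1); (i 0, i 2); (i 0, i 3); (i 1, i 2); (i 1, i 3); (i 2, i 3)]%N.

(** The four orders insert 3 into 0, 1, 2, so the leading block stays strictly upper triangular. *)
Lemma ordered_has_dim ix l : admissible4 V ix (@strict_upper3 K) ->
  l \in [:: [:: 0; 1; 2; 3]; [:: 0; 1; 3; 2]; [:: 0; 3; 1; 2]; [:: 3; 0; 1; 2]]%N ->
  (forall x, Z x -> forall a b, (a < 4)%N -> (b < 4)%N -> (a, b) \notin order_pairs l ->
     x 0 (ix a b) = 0) ->
  has_dim Z 6.
Proof.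
move=> ok; rewrite !inE => /or4P[] /eqP->;
  apply: (linear_has_dim ok) => // Y z;
  (split; first by split; [split|..]; apply: z);
  have [z10 z20 z21] : [/\ Y 1 0 = 0, Y 2 0 = 0 & Y 2 1 = 0] by split; apply: z.
- have [z30 z31 z32] : [/\ Y 3 0 = 0, Y 3 1 = 0 & Y 3 2 = 0] by split; apply: z.
  by split; rewrite ?z10 ?z20 ?z21 ?z30 ?z31 ?z32; [apply: z|ring..].
- have [z30 z31 z23] : [/\ Y 3 0 = 0, Y 3 1 = 0 & Y 2 3 = 0] by split; apply: z.
  by split; rewrite ?z10 ?z20 ?z21 ?z30 ?z31 ?z23; [apply: z|ring..].
- have [z30 z13 z23] : [/\ Y 3 0 = 0, Y 1 3 = 0 & Y 2 3 = 0] by split; apply: z.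
  by split; rewrite ?z10 ?z20 ?z21 ?z30 ?z13 ?z23; [apply: z|ring..].
- have [z03 z13 z23] : [/\ Y 0 3 = 0, Y 1 3 = 0 & Y 2 3 = 0] by split; apply: z.
  by split; rewrite ?z10 ?z20 ?z21 ?z03 ?z13 ?z23; [apply: z|ring..].
Qed.

(** Split (q . u) p_2 = 0 and look for a pivot among q_0, q_1 or p_0, p_1, up to exchanging 0 and 1.
    Without a pivot, Z is strictly triangular for some order. *)
Lemma column_has_dim ix : admissible4 V ix (@strict_upper3 K) ->
  holds_on ix (@last_column3 K) -> has_dim Z 6.
Proof.
move=> ok colZ.
have okC : admissible4 V ix (@last_column3 K).
  by have [ixP H] := ok; split=> // x [+ _]; apply: H.
have sw : [:: 1; 0; 2; 3]%N \in perms3 by [].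
have okS : admissible4 V (permute [:: 1; 0; 2; 3]%N ix) (@last_column3 K).
  by apply: admissible4_perm okC => // Y c; apply/last_column3_swap.
have colS : holds_on (permute [:: 1; 0; 2; 3]%N ix) (@last_column3 K).
  by apply: holds_on_perm colZ => // Y c; apply/(last_column3_swap Y).
case: (@zero_onM _ _ _ _ compZ (fun x => x 0 (ix 3 0) * x 0 (ix 0 2) + x 0 (ix 3 1) * x 0 (ix 1 2))
  (fun x => x 0 (ix 2 3))).
- by apply: regularD; apply: regularM; apply: regularX.
- exact: regularX.
- move=> x Zx; have [[[_ z10 z20 z21] z01] [z33 _ g3 _]] := colZ x Zx.
  by rewrite -[RHS]g3 z10 z20 z21 z01; ring.
- move=> qu.
  case: (classic (entry0 ix 3 0)) => [q0|]; last exact: typeII_has_dim.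
  case: (classic (entry0 ix 3 1)) => [q1|]; last first.
    by apply: (typeII_has_dim okS colS) => x Zx; rewrite -[RHS](qu x Zx) addrC.
  case: (@zero_onM _ _ _ _ compZ (fun x => x 0 (ix 3 2)) (fun x => x 0 (ix 2 3))).
  + exact: regularX.
  + exact: regularX.
  + move=> x Zx; have [_ [_ g2 _ _]] := colZ x Zx.
    by rewrite -[RHS]g2 (q0 x Zx) (q1 x Zx); ring.
  + move=> q2; apply: (ordered_has_dim (l := [:: 0; 1; 2; 3]%N) ok) => // x Zx.
    have [[[[z00 z11 z22] z10 z20 z21] z01] [z33 _ _ _]] := colZ x Zx.
    by have := q0 x Zx; have := q1 x Zx; have := q2 x Zx => z32 z31 z30; entry_cases4.
  + move=> p2; apply: (ordered_has_dim (l := [:: 0; 1; 3; 2]%N) ok) => // x Zx.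
    have [[[[z00 z11 z22] z10 z20 z21] z01] [z33 _ _ _]] := colZ x Zx.
    by have := q0 x Zx; have := q1 x Zx; have := p2 x Zx => z23 z31 z30; entry_cases4.
- move=> p2; case: (classic (entry0 ix 0 3)) => [p0|]; last exact: typeI_has_dim.
  case: (classic (entry0 ix 1 3)) => [p1|]; last exact: (typeI_has_dim okS colS).
  apply: (ordered_has_dim (l := [:: 3; 0; 1; 2]%N) ok) => // x Zx.
  have [[[[z00 z11 z22] z10 z20 z21] z01] [z33 _ _ _]] := colZ x Zx.
  by have := p0 x Zx; have := p1 x Zx; have := p2 x Zx => z23 z13 z03; entry_cases4.
Qed.

Lemma triangular_has_dim ix : admissible4 V ix (@strict_upper3 K) ->
  holds_on ix (@strict_upper3 K) -> has_dim Z 6.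
Proof.
move=> ok triZ.
have column : entry0 ix 0 1 -> has_dim Z 6.
  move=> E; apply: (column_has_dim ok) => x Zx; have [t e] := triZ x Zx.
  by split=> //; split=> //; apply: E.
(* Transposing and reversing 0, 1, 2 preserves strict upper triangularity and turns A_12 = 0 into
   A_01 = 0. *)
have row : entry0 ix 1 2 -> has_dim Z 6.
  move=> E; have rv : [:: 2; 1; 0; 3]%N \in perms3 by [].
  have ok' : admissible4 V (transpose (permute [:: 2; 1; 0; 3]%N ix)) (@strict_upper3 K).
    apply: (@admissible4_tr _ (fun Y => strict_upper3 (transpose Y))) => //.
    by apply: admissible4_perm ok => // Y [[? ? ?] ? ? ?].
  apply: (column_has_dim ok').
  apply: (@holds_on_tr _ (fun Y => last_column3 (transpose Y))) => //.
  apply: (@holds_on_perm _ (fun Y => strict_upper3 Y /\ Y 1 2 = 0)) => //.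
    by move=> Y [[[? ? ?] ? ? ?] ?].
  by move=> x Zx; have [t e] := triZ x Zx; split=> //; split=> //; apply: E.
have rX k l := @regularX K N (ix k l).
have split2 a b c d : zero_on Z (fun x => x 0 (ix a b) * x 0 (ix c d)) ->
    entry0 ix a b \/ entry0 ix c d by exact: (zero_onM compZ).
have split3 a b c d i j :
    zero_on Z (fun x => x 0 (ix a b) * (x 0 (ix c d) * x 0 (ix i j))) ->
    [\/ entry0 ix a b, entry0 ix c d | entry0 ix i j].
  case/(zero_onM compZ (rX a b) (regularM (rX c d) (rX i j))) => [H|/split2[]H].
  - by apply: Or31.
  - by apply: Or32.
  - by apply: Or33.
have ordered l u v w :
    l \in [:: [:: 0; 1; 2; 3]; [:: 0; 1; 3; 2]; [:: 0; 3; 1; 2]; [:: 3; 0; 1; 2]]%N ->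
    (forall Y, [/\ [/\ Y 0 0 = 0, Y 1 1 = 0, Y 2 2 = 0 & Y 3 3 = 0],
       [/\ Y 1 0 = 0, Y 2 0 = 0 & Y 2 1 = 0] &
       [/\ Y u.1 u.2 = 0, Y v.1 v.2 = 0 & Y w.1 w.2 = 0]] ->
       forall a b, (a < 4)%N -> (b < 4)%N -> (a, b) \notin order_pairs l -> Y a b = 0 :> K) ->
    entry0 ix u.1 u.2 -> entry0 ix v.1 v.2 -> entry0 ix w.1 w.2 -> has_dim Z 6.
  move=> ll lY u0 v0 w0; apply: (ordered_has_dim ok ll) => x Zx.
  have [[[z00 z11 z22] z10 z20 z21] [z33 _ _ _]] := triZ x Zx.
  by apply: (lY (entries ix x)); split; split=> //; [apply: u0|apply: v0|apply: w0].
have o3012 : entry0 ix 0 3 -> entry0 ix 1 3 -> entry0 ix 2 3 -> has_dim Z 6.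
  apply: (ordered [:: 3; 0; 1; 2]%N (0,3)%N (1,3)%N (2,3)%N) => // Y.
  by move=> [[? ? ? ?] [? ? ?] [? ? ?]]; entry_cases4.
have o0312 : entry0 ix 3 0 -> entry0 ix 1 3 -> entry0 ix 2 3 -> has_dim Z 6.
  apply: (ordered [:: 0; 3; 1; 2]%N (3,0)%N (1,3)%N (2,3)%N) => // Y.
  by move=> [[? ? ? ?] [? ? ?] [? ? ?]]; entry_cases4.
have o0132 : entry0 ix 3 0 -> entry0 ix 3 1 -> entry0 ix 2 3 -> has_dim Z 6.
  apply: (ordered [:: 0; 1; 3; 2]%N (3,0)%N (3,1)%N (2,3)%N) => // Y.
  by move=> [[? ? ? ?] [? ? ?] [? ? ?]]; entry_cases4.
have o0123 : entry0 ix 3 0 -> entry0 ix 3 1 -> entry0 ix 3 2 -> has_dim Z 6.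
  apply: (ordered [:: 0; 1; 2; 3]%N (3,0)%N (3,1)%N (3,2)%N) => // Y.
  by move=> [[? ? ? ?] [? ? ?] [? ? ?]]; entry_cases4.
have q0p2 : entry0 ix 3 0 -> entry0 ix 2 3 -> has_dim Z 6.
  move=> q0 p2; case: (split2 3 1 1 3)%N => [x Zx|q1|p1].
  - have [_ [_ g2 _ _]] := triZ x Zx.
    by rewrite -[RHS]g2 (q0 x Zx) (p2 x Zx); ring.
  - exact: o0132.
  - exact: o0312.
(* For triangular A, q A^2 p = q_0 A_01 A_12 p_2. If A_01 and A_12 survive, q A p and q p also
   reduce to single products and lead to one of the four orders. *)
case: (zero_onM compZ (rX 3 0)%N (regularM (rX 0 1)%N (regularM (rX 1 2)%N (rX 2 3)%N)))
  => [x Zx|q0|/split3[//|//|p2]].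
- have [[_ z10 z20 z21] [_ _ _ g4]] := triZ x Zx.
  by rewrite -[RHS]g4 z10 z20 z21; ring.
- case: (split3 3 1 1 2 2 3)%N => [x Zx|q1|//|]; last exact: q0p2.
    have [[_ z10 z20 z21] [_ _ g3 _]] := triZ x Zx.
    by rewrite -[RHS]g3 (q0 x Zx) z10 z20 z21; ring.
  case: (split2 3 2 2 3)%N => [x Zx|q2|p2]; [|exact: o0123|exact: o0132].
  have [_ [_ g2 _ _]] := triZ x Zx.
  by rewrite -[RHS]g2 (q0 x Zx) (q1 x Zx); ring.
- case: (split3 3 0 0 1 1 3)%N => [x Zx|/q0p2|//|p1]; [|exact|].
    have [[_ z10 z20 z21] [_ _ g3 _]] := triZ x Zx.
    by rewrite -[RHS]g3 (p2 x Zx) z10 z20 z21; ring.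
  case: (split2 3 0 0 3)%N => [x Zx|q0|p0]; [|exact: o0312|exact: o3012].
  have [_ [_ g2 _ _]] := triZ x Zx.
  by rewrite -[RHS]g2 (p1 x Zx) (p2 x Zx); ring.
Qed.

End Components4.

(** * Components over the quadric c . b = 0 *)

Section Quadric4.

Variables (K : closedFieldType) (N : nat) (V Z : pset K N).
Hypotheses (clV : zclosed V) (compZ : irr_component V Z).
Implicit Types (ix : nat -> nat -> 'I_N) (Y : nat -> nat -> K) (C : (nat -> nat -> K) -> Prop).

Local Notation entries ix x := (fun a b : nat => x 0 (ix a b)).
Local Notation entry0 ix a b := (zero_on Z (fun x : 'rV[K]_N => x 0 (ix a b))).

(* Here A = [0, b; c, 0] with c . b = 0, so that A^2 = b c and
   q A^2 p = (q . b) (c . p). *)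
Lemma quadric_row0_pivot ix : admissible4 V ix (@quadric3 K) -> holds_on Z ix (@quadric3 K) ->
  entry0 ix 3 0 -> entry0 ix 3 1 -> entry0 ix 3 2 -> ~ entry0 ix 0 2 -> has_dim Z 6.
Proof.
move=> [ixP VP] H q0 q1 q2 b0.
apply: (pivot_chart_has_dim (s := [:: (0,2); (1,2); (2,1); (0,3); (1,3); (2,3)]%N)
  (g := Some (0,2)%N) (deps := [:: ((2,0), [:: (true, ((2,1), (1,2)))])]%N) ixP clV compZ) => //.
- move=> x g0 R; have z a b := chart_rel_eq0 (a := a) (b := b) g0 R.
  have := R 2%N 0%N isT isT isT; rewrite /= addr0 => e20.
  have [z30 z31 z32] : [/\ entries ix x 3 0 = 0, entries ix x 3 1 = 0 & entries ix x 3 2 = 0].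
    by split; apply: z.
  apply: VP; first by split; [split|..]; try (by apply: z); ring: e20.
  by split; [by apply: z|..]; rewrite z30 z31 z32; ring.
- move=> x Zx; have [[[z00 z11 z22] z01 z10 f2] [z33 _ _ _]] := H x Zx.
  have := q0 x Zx; have := q1 x Zx; have := q2 x Zx => z32 z31 z30.
  entry_cases4; rewrite ?z00 ?z11 ?z22 ?z01 ?z10 ?z33 ?z30 ?z31 ?z32 ?mulr0 //.
  by apply/subr0_eq; rewrite -[RHS]f2; ring.
Qed.

(** Here p_2 = 0 and (p_0, p_1) is parallel to b, while c and (q_0, q_1) are orthogonal to b: all
    the last equations follow. The pivot b_0 determines c_0, q_0 and p_1. *)
Lemma quadric_parallel_pivot ix :
  admissible4 V ix (@quadric3 K) -> holds_on Z ix (@quadric3 K) -> entry0 ix 2 3 ->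
  zero_on Z (fun x => x 0 (ix 3 0) * x 0 (ix 0 2) + x 0 (ix 3 1) * x 0 (ix 1 2)) ->
  zero_on Z (fun x => x 0 (ix 0 2) * x 0 (ix 1 3) - x 0 (ix 1 2) * x 0 (ix 0 3)) ->
  ~ entry0 ix 0 2 -> has_dim Z 6.
Proof.
move=> [ixP VP] H p2 qb bp b0.
apply: (pivot_chart_has_dim (s := [:: (0,2); (1,2); (2,1); (3,1); (3,2); (0,3)]%N)
  (g := Some (0,2)%N) (deps := [:: ((2,0), [:: (true, ((2,1), (1,2)))]);
    ((3,0), [:: (true, ((3,1), (1,2)))]); ((1,3), [:: (false, ((0,3), (1,2)))])]%N)
  ixP clV compZ) => //.
- move=> x g0 R; have z a b := chart_rel_eq0 (a := a) (b := b) g0 R.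
  have := R 2%N 0%N isT isT isT; rewrite /= addr0 => e20.
  have := R 3%N 0%N isT isT isT; rewrite /= addr0 => e30.
  have := R 1%N 3%N isT isT isT; rewrite /= addr0 => e13.
  have [z01 z10 z23] : [/\ entries ix x 0 1 = 0, entries ix x 1 0 = 0 & entries ix x 2 3 = 0].
    by split; apply: z.
  apply: VP; first by split; [split|..]; try (by apply: z); ring: e20.
  split; first by apply: z.
  (* Multiplying by the pivot makes the products b_0 q_0 and b_0 p_1 appear, whose values are
     known. *)
  + apply: (mulfI g0); rewrite /= z23.
    rewrite [LHS](_ : _ = x 0 (ix 0 3) * (x 0 (ix 0 2) * x 0 (ix 3 0)) +
      x 0 (ix 3 1) * (x 0 (ix 0 2) * x 0 (ix 1 3))); last by ring.
    by rewrite e30 e13; ring.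
  + apply: (mulfI g0); rewrite /= z23 z01 z10.
    rewrite [LHS](_ : _ = x 0 (ix 3 2) * (x 0 (ix 0 3) * (x 0 (ix 0 2) * x 0 (ix 2 0)) +
      x 0 (ix 2 1) * (x 0 (ix 0 2) * x 0 (ix 1 3)))); last by ring.
    by rewrite e20 e13; ring.
  + by rewrite z23 z01 z10; ring: e30.
- move=> x Zx; have [[[z00 z11 z22] z01 z10 f2] [z33 _ _ _]] := H x Zx.
  have z23 := p2 x Zx; have qbx := qb x Zx; have bpx := bp x Zx.
  entry_cases4; rewrite ?z00 ?z11 ?z22 ?z01 ?z10 ?z33 ?z23 ?mulr0 //.
  + by apply/subr0_eq; rewrite -[RHS]bpx; ring.
  + by apply/subr0_eq; rewrite -[RHS]f2; ring.
  + by apply/subr0_eq; rewrite -[RHS]qbx; ring.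
Qed.

Lemma quadric3_swap Y : quadric3 (permute [:: 1; 0; 2; 3]%N Y) <-> quadric3 Y.
Proof.
by split=> [] [[z00 z11 z22] z01 z10 f2]; rewrite /permute /= in f2 *;
  split=> //; rewrite -[RHS]f2 addrC.
Qed.

Lemma quadric3_tr Y : quadric3 (transpose Y) <-> quadric3 Y.
Proof.
by split=> [] [[z00 z11 z22] z01 z10 f2]; rewrite /transpose /= in f2 *;
  split=> //; rewrite -[RHS]f2; ring.
Qed.

Definition quadric_on ix := admissible4 V ix (@quadric3 K) /\ holds_on Z ix (@quadric3 K).

Lemma quadric_on_swap ix : quadric_on ix -> quadric_on (permute [:: 1; 0; 2; 3]%N ix).
Proof.
move=> [ok H]; have sw : [:: 1; 0; 2; 3]%N \in perms3 by [].
split; first by apply: (admissible4_perm sw) ok => Y /quadric3_swap.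
by apply: (holds_on_perm sw) H => Y c; apply/(quadric3_swap Y).
Qed.

Lemma quadric_on_tr ix : quadric_on ix -> quadric_on (transpose ix).
Proof.
move=> [ok H]; split; first by apply: admissible4_tr ok => Y /quadric3_tr.
by apply: holds_on_tr H => Y c; apply/(quadric3_tr Y).
Qed.

Lemma quadric_row0 ix : quadric_on ix ->
  entry0 ix 3 0 -> entry0 ix 3 1 -> entry0 ix 3 2 ->
  ~ (entry0 ix 0 2 /\ entry0 ix 1 2) -> has_dim Z 6.
Proof.
move=> qix q0 q1 q2 nb; have [ok H] := qix.
case: (classic (entry0 ix 0 2)) => [b0|]; last exact: quadric_row0_pivot.
have [okS HS] := quadric_on_swap qix.
by apply: (quadric_row0_pivot okS HS) => // b1; apply: nb.
Qed.

Lemma quadric_parallel ix : quadric_on ix -> entry0 ix 2 3 ->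
  zero_on Z (fun x => x 0 (ix 3 0) * x 0 (ix 0 2) + x 0 (ix 3 1) * x 0 (ix 1 2)) ->
  zero_on Z (fun x => x 0 (ix 0 2) * x 0 (ix 1 3) - x 0 (ix 1 2) * x 0 (ix 0 3)) ->
  ~ (entry0 ix 0 2 /\ entry0 ix 1 2) -> has_dim Z 6.
Proof.
move=> qix p2 qb bp nb; have [ok H] := qix.
case: (classic (entry0 ix 0 2)) => [b0|]; last exact: quadric_parallel_pivot.
have [okS HS] := quadric_on_swap qix.
apply: (quadric_parallel_pivot okS HS) => // [x Zx|x Zx|b1]; last exact: nb.
  by rewrite -[RHS](qb x Zx) addrC.
by rewrite /permute /= -[RHS]oppr0 -(bp x Zx); ring.
Qed.

(** Cancels a vector (u, v) that is not identically zero on Z; plane linear algebra over the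
    function field of Z is carried out this way. *)
Lemma zero_on_cancel2 (u v f : 'rV[K]_N -> K) : regular u -> regular v -> regular f ->
  ~ (zero_on Z u /\ zero_on Z v) ->
  zero_on Z (fun x => u x * f x) -> zero_on Z (fun x => v x * f x) -> zero_on Z f.
Proof.
move=> ru rv rf nuv /(zero_onM compZ ru rf)[u0|//] /(zero_onM compZ rv rf)[v0|//].
by case: nuv.
Qed.

Let lin2 (a f b g : K) : f = 0 -> g = 0 -> a * f + b * g = 0.
Proof. by move=> -> ->; rewrite !mulr0 addr0. Qed.

Let X ix k l := fun x : 'rV[K]_N => x 0 (ix k l).
Let rX ix k l : regular (X ix k l) := @regularX K N (ix k l).
Let r2 ix i j k l i' j' k' l' :
  regular (fun x => X ix i j x * X ix k l x + X ix i' j' x * X ix k' l' x).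
Proof. by apply: regularD; apply: regularM; apply: rX. Qed.
Let r2N ix i j k l i' j' k' l' :
  regular (fun x => X ix i j x * X ix k l x - X ix i' j' x * X ix k' l' x).
Proof. by apply: regularD; [|apply: regularN]; apply: regularM; apply: rX. Qed.

(** Writing q and p for their first two entries in dot products, q . b = 0 reduces q A p = 0 to q_2
    (c . p) = 0. If c . p = 0, then p is parallel to b and q . p = 0, so q_2 p_2 = 0 and the
    parallel chart or its transpose applies. If q_2 = 0, either q = 0 or c . p = 0 again. *)
Lemma quadric_orthogonal ix : quadric_on ix ->
  ~ (entry0 ix 0 2 /\ entry0 ix 1 2) -> ~ (entry0 ix 2 0 /\ entry0 ix 2 1) ->
  zero_on Z (fun x => x 0 (ix 3 0) * x 0 (ix 0 2) + x 0 (ix 3 1) * x 0 (ix 1 2)) ->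
  has_dim Z 6.
Proof.
move=> qix nb nc qb; have [_ H] := qix.
(* c and q are both orthogonal to the nonzero plane vector b, hence parallel. *)
have qc : zero_on Z (fun x => x 0 (ix 2 0) * x 0 (ix 3 1) - x 0 (ix 2 1) * x 0 (ix 3 0)).
  apply: (zero_on_cancel2 (rX ix 0 2)%N (rX ix 1 2)%N (@r2N ix 2 0 3 1 2 1 3 0)%N nb) => x Zx;
    have [[_ _ _ f2] _] := H x Zx; rewrite /X.
  - by rewrite -[RHS](lin2 (x 0 (ix 3 1)) (- x 0 (ix 2 1)) f2 (qb x Zx)); ring.
  - by rewrite -[RHS](lin2 (- x 0 (ix 3 0)) (x 0 (ix 2 0)) f2 (qb x Zx)); ring.
have both : zero_on Z (fun x => x 0 (ix 2 0) * x 0 (ix 0 3) + x 0 (ix 2 1) * x 0 (ix 1 3)) ->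
    has_dim Z 6.
  move=> cp.
  have bp : zero_on Z (fun x => x 0 (ix 0 2) * x 0 (ix 1 3) - x 0 (ix 1 2) * x 0 (ix 0 3)).
    apply: (zero_on_cancel2 (rX ix 2 0)%N (rX ix 2 1)%N (@r2N ix 0 2 1 3 1 2 0 3)%N nc) => x Zx;
      have [[_ _ _ f2] _] := H x Zx; rewrite /X.
    - by rewrite -[RHS](lin2 (x 0 (ix 1 3)) (- x 0 (ix 1 2)) f2 (cp x Zx)); ring.
    - by rewrite -[RHS](lin2 (- x 0 (ix 0 3)) (x 0 (ix 0 2)) f2 (cp x Zx)); ring.
  have qp : zero_on Z (fun x => x 0 (ix 3 0) * x 0 (ix 0 3) + x 0 (ix 3 1) * x 0 (ix 1 3)).
    apply: (zero_on_cancel2 (rX ix 0 2)%N (rX ix 1 2)%N (@r2 ix 3 0 0 3 3 1 1 3)%N nb) => x Zx;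
      rewrite /X.
    - by rewrite -[RHS](lin2 (x 0 (ix 0 3)) (x 0 (ix 3 1)) (qb x Zx) (bp x Zx)); ring.
    - by rewrite -[RHS](lin2 (x 0 (ix 1 3)) (- x 0 (ix 3 0)) (qb x Zx) (bp x Zx)); ring.
  case: (zero_onM compZ (rX ix 3 2) (rX ix 2 3))%N => [x Zx|q2|p2].
  - have [_ [_ g2 _ _]] := H x Zx; have := qp x Zx; rewrite /X => qpx.
    by rewrite -[RHS]g2 qpx add0r.
  (* Transposition exchanges b with c and p with q, turning q_2 = 0 into p_2 = 0. *)
  - apply: (quadric_parallel (quadric_on_tr qix)) => // x Zx.
    by rewrite -[RHS](cp x Zx) /transpose; ring.
  - exact: quadric_parallel qix p2 qb bp nb.
case: (zero_onM compZ (rX ix 3 2) (@r2 ix 2 0 0 3 2 1 1 3))%N => [x Zx|q2|//].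
  have [[_ z01 z10 _] [_ _ g3 _]] := H x Zx; rewrite /X.
  by rewrite -[RHS](lin2 1 (- x 0 (ix 2 3)) g3 (qb x Zx)) z01 z10; ring.
case: (classic (entry0 ix 3 0 /\ entry0 ix 3 1)) => [[q0 q1]|nq].
  exact: quadric_row0 qix q0 q1 q2 nb.
(* Now q . p = 0, and c is parallel to the nonzero q, so c . p = 0. *)
apply: both.
apply: (zero_on_cancel2 (rX ix 3 0)%N (rX ix 3 1)%N (@r2 ix 2 0 0 3 2 1 1 3)%N nq) => x Zx;
  have [_ [_ g2 _ _]] := H x Zx; have z32 := q2 x Zx; rewrite /X in z32 *.
- by rewrite -[RHS](lin2 (x 0 (ix 2 0)) (- x 0 (ix 1 3)) g2 (qc x Zx)) z32; ring.
- by rewrite -[RHS](lin2 (x 0 (ix 2 1)) (x 0 (ix 0 3)) g2 (qc x Zx)) z32; ring.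
Qed.

(** Modulo c . b = 0, q A^2 p is (q . b) (c . p); transposition exchanges the two factors. *)
Lemma quadric_has_dim ix : quadric_on ix ->
  ~ (entry0 ix 0 2 /\ entry0 ix 1 2) -> ~ (entry0 ix 2 0 /\ entry0 ix 2 1) ->
  has_dim Z 6.
Proof.
move=> qix nb nc; have [_ H] := qix.
case: (zero_onM compZ (@r2 ix 3 0 0 2 3 1 1 2) (@r2 ix 2 0 0 3 2 1 1 3))%N => [x Zx|qb|cp].
- have [[_ z01 z10 f2] [_ _ _ g4]] := H x Zx; rewrite /X.
  rewrite -[RHS](lin2 1 (- (x 0 (ix 3 2) * x 0 (ix 2 3))) g4 f2) z01 z10; ring.
- exact: quadric_orthogonal qix nb nc qb.
- apply: (quadric_orthogonal (quadric_on_tr qix) nc nb) => x Zx.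
  by rewrite -[RHS](cp x Zx) /X /transpose; ring.
Qed.

End Quadric4.

(** * Components for n = 2, 3, 4 *)

Ltac entry_cases3 := let H := fresh in
  move=> [|[|[|?]]] [|[|[|?]]] // _ _ H; (try by move: H); clear H; rewrite /=.

Section SmallCases.

Variables (K : closedFieldType) (N : nat) (V Z : pset K N).
Hypotheses (clV : zclosed V) (compZ : irr_component V Z).
Variable ix : nat -> nat -> 'I_N.

Local Notation entries x := (fun a b : nat => x 0 (ix a b)).
Local Notation entry0 a b := (zero_on Z (fun x : 'rV[K]_N => x 0 (ix a b))).

Let rX k l : regular (fun x => x 0 (ix k l)) := @regularX K N (ix k l).

Let split2 a b c d : zero_on Z (fun x => x 0 (ix a b) * x 0 (ix c d)) ->
  entry0 a b \/ entry0 c d.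
Proof. exact: (zero_onM compZ). Qed.

(* The second alternative is A = [0, b; c, 0] with b and c not identically zero:
   for n = 3, the only component that is not a coordinate subspace. *)
Definition nilpotent_pattern3 : Prop :=
  (exists2 l, l \in perms3 & forall x, Z x -> strict_upper3 (permute l (entries x))) \/
  [/\ entry0 0 1, entry0 1 0, ~ (entry0 0 2 /\ entry0 1 2) & ~ (entry0 2 0 /\ entry0 2 1)].

(** With A_ji = 0 only c_i A_ij b_j = 0 remains of c A b = 0. Splitting it, and c . b = 0 when
    needed, yields a triangular order unless A_ij = 0 with b and c both nonzero. *)
Lemma gt_eqs3_half i j : (i, j) \in [:: (0, 1); (1, 0)]%N ->
  (forall x, Z x -> [/\ x 0 (ix i i) = 0, x 0 (ix j j) = 0 & x 0 (ix 2 2) = 0]) ->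
  entry0 j i ->
  zero_on Z (fun x => x 0 (ix 2 i) * x 0 (ix i 2) + x 0 (ix 2 j) * x 0 (ix j 2)) ->
  zero_on Z (fun x => x 0 (ix 2 i) * (x 0 (ix i j) * x 0 (ix j 2))) ->
  nilpotent_pattern3.
Proof.
move=> ij diag zji f2 f3.
have p_ij2 : entry0 2 i -> entry0 2 j -> nilpotent_pattern3.
  move=> z2i z2j; left; exists [:: i; j; 2; 3]%N.
    by move: ij; rewrite !inE !xpair_eqE => /orP[] /andP[/eqP-> /eqP->].
  move=> x Zx; have [? ? ?] := diag x Zx.
  by split; [split|apply: zji|apply: z2i|apply: z2j].
have p_i2j : entry0 2 i -> entry0 j 2 -> nilpotent_pattern3.
  move=> z2i zj2; left; exists [:: i; 2; j; 3]%N.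
    by move: ij; rewrite !inE !xpair_eqE => /orP[] /andP[/eqP-> /eqP->].
  move=> x Zx; have [? ? ?] := diag x Zx.
  by split; [split|apply: z2i|apply: zji|apply: zj2].
have p_2ij : entry0 i 2 -> entry0 j 2 -> nilpotent_pattern3.
  move=> zi2 zj2; left; exists [:: 2; i; j; 3]%N.
    by move: ij; rewrite !inE !xpair_eqE => /orP[] /andP[/eqP-> /eqP->].
  move=> x Zx; have [? ? ?] := diag x Zx.
  by split; [split|apply: zi2|apply: zj2|apply: zji].
case: (zero_onM compZ (rX 2 i) (regularM (rX i j) (rX j 2)) f3) => [z2i|].
  case: (@split2 2 j j 2) => [x Zx| |]; [|exact: p_ij2|exact: p_i2j].
  by rewrite -[RHS](f2 x Zx) (z2i x Zx) mul0r add0r.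
move/split2 => [zij|zj2]; last first.
  case: (@split2 2 i i 2) => [x Zx|/p_i2j|/p_2ij]; [|exact|exact].
  by rewrite -[RHS](f2 x Zx) (zj2 x Zx) mulr0 addr0.
case: (classic (entry0 i 2 /\ entry0 j 2)) => [[zi2 zj2]|nb]; first exact: p_2ij.
case: (classic (entry0 2 i /\ entry0 2 j)) => [[z2i z2j]|nc]; first exact: p_ij2.
right; move: ij zij zji nb nc; rewrite !inE !xpair_eqE => /orP[] /andP[/eqP-> /eqP->] //.
by split=> // -[]; tauto.
Qed.

Lemma gt_eqs3_pattern : (forall x, Z x -> gt_eqs3 (entries x)) -> nilpotent_pattern3.
Proof.
move=> H; case: (@split2 0 1 1 0)%N => [x /H[[]]//|z01|z10].
  apply: (@gt_eqs3_half 1 0)%N => // x Zx; have [[? ? _] ? f2 f3] := H x Zx => //.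
    by rewrite -[RHS]f2; ring.
  by rewrite -[RHS]f3 (z01 x Zx); ring.
apply: (@gt_eqs3_half 0 1)%N => // x Zx; have [[? ? _] ? f2 f3] := H x Zx => //.
by rewrite -[RHS]f3 (z10 x Zx); ring.
Qed.

Lemma gt_eqs2_has_dim : reindexing 2 ix ->
  (forall x, V x <-> gt_eqs2 (entries x)) -> has_dim Z 1.
Proof.
move=> ixP VE; have [[_ _ ZV] _] := compZ.
have H x : Z x -> gt_eqs2 (entries x) by move=> /ZV/VE.
case: (@split2 0 1 1 0)%N => [x /H[]//|z01|z10].
  apply: (linear_chart_has_dim (s := [:: (1, 0)]%N) ixP clV compZ) => // [x z|x Zx].
    apply/VE; split; try by apply: z.
    by rewrite (z 0 1)%N // mul0r.
  have [? ? _] := H x Zx; have := z01 x Zx => ?.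
  by move=> [|[|?]] [|[|?]].
apply: (linear_chart_has_dim (s := [:: (0, 1)]%N) ixP clV compZ) => // [x z|x Zx].
  apply/VE; split; try by apply: z.
  by rewrite (z 1 0)%N // mulr0.
have [? ? _] := H x Zx; have := z10 x Zx => ?.
by move=> [|[|?]] [|[|?]].
Qed.

Lemma gt_eqs3_has_dim : reindexing 3 ix ->
  (forall x, V x <-> gt_eqs3 (entries x)) -> has_dim Z 3.
Proof.
move=> ixP VE; have [[_ _ ZV] _] := compZ.
have H x : Z x -> gt_eqs3 (entries x) by move=> /ZV/VE.
case: (gt_eqs3_pattern H) => [[l pl lZ]|[z01 z10 nb _]].
  pose i := nth 0%N l.
  apply: (linear_chart_has_dim (s := [:: (i 0, i 1); (i 0, i 2); (i 1, i 2)]%N) ixP clV compZ).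
  - by move: pl; rewrite /i !inE => /or4P[||| /or3P[]] /eqP->.
  - by move: pl; rewrite /i !inE => /or4P[||| /or3P[]] /eqP->.
  - move=> x z; apply/VE/(strict_upper3_eqs pl).
    by move: pl z; rewrite /i !inE /permute => /or4P[||| /or3P[]] /eqP-> z;
      (split; [split|..]); apply: z.
  - move=> x Zx; move: pl (lZ x Zx); rewrite /i !inE => /or4P[||| /or3P[]] /eqP->;
      by rewrite /permute /= => -[[? ? ?] ? ? ?]; entry_cases3.
(* b is not identically zero on Z, so b_1 or b_0 serves as pivot for c . b = 0. *)
case: (classic (entry0 0 2)) => [b0|nb0].
  apply: (pivot_chart_has_dim (s := [:: (0,2); (1,2); (2,0)]%N) (g := Some (1,2)%N)
    (deps := [:: ((2,1), [:: (true, ((2,0), (0,2)))])]%N) ixP clV compZ) => //.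
  - move=> x g0 R; have z a b := chart_rel_eq0 (a := a) (b := b) g0 R.
    have := R 2%N 1%N isT isT isT; rewrite /= addr0 => e21.
    apply/VE/quadric3_eqs; split; [split|..]; try by apply: z.
    by ring: e21.
  - by move=> b1; apply: nb.
  - move=> x Zx; have [[z00 z11 _] z22 f2 _] := H x Zx.
    have := z01 x Zx; have := z10 x Zx => e10 e01.
    entry_cases3; rewrite ?z00 ?z11 ?z22 ?e01 ?e10 ?mulr0 //.
    by apply/subr0_eq; rewrite -[RHS]f2; ring.
apply: (pivot_chart_has_dim (s := [:: (0,2); (1,2); (2,1)]%N) (g := Some (0,2)%N)
  (deps := [:: ((2,0), [:: (true, ((2,1), (1,2)))])]%N) ixP clV compZ) => //.
- move=> x g0 R; have z a b := chart_rel_eq0 (a := a) (b := b) g0 R.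
  have := R 2%N 0%N isT isT isT; rewrite /= addr0 => e20.
  apply/VE/quadric3_eqs; split; [split|..]; try by apply: z.
  by ring: e20.
- move=> x Zx; have [[z00 z11 _] z22 f2 _] := H x Zx.
  have := z01 x Zx; have := z10 x Zx => e10 e01.
  entry_cases3; rewrite ?z00 ?z11 ?z22 ?e01 ?e10 ?mulr0 //.
  by apply/subr0_eq; rewrite -[RHS]f2; ring.
Qed.

Lemma gt_eqs4_has_dim : reindexing 4 ix ->
  (forall x, V x <-> gt_eqs4 (entries x)) -> has_dim Z 6.
Proof.
move=> ixP VE; have [[_ _ ZV] _] := compZ.
have H x : Z x -> gt_eqs4 (entries x) by move=> /ZV/VE.
have ok : admissible4 V ix (@gt_eqs3 K) by split=> // x ? ?; apply/VE.
case: (@gt_eqs3_pattern) => [x /H[]//|[l pl lZ]|[z01 z10 nb nc]].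
  apply: (@triangular_has_dim _ _ _ _ clV compZ (permute l ix)).
    by apply: (admissible4_perm pl) ok => Y; apply: strict_upper3_eqs.
  move=> x Zx; split; first exact: lZ.
  by have [_ e] := H x Zx; apply/(last_eqs4_perm (entries x) pl).
apply: (quadric_has_dim clV compZ (ix := ix)) => //; split.
  by split=> // x c e; apply/VE; split=> //; apply: quadric3_eqs.
move=> x Zx; have [[[z00 z11 _] z22 f2 _] e] := H x Zx.
by split=> //; split=> //; [apply: z01|apply: z10].
Qed.

End SmallCases.

Local Close Scope ring_scope.
Unset Implicit Arguments.

Theorem theorem5p2 (K : closedFieldType) (hchar : [pchar K]%R =i pred0)
    (n : nat) (hn : n = 2 \/ n = 3 \/ n = 4) :
  equidimensional (gt_variety K n) ((n * (n - 1)) %/ 2).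
Proof.
have reindexing_coord m : reindexing m.+1 (coord m).
  by split=> [a b a' b'|i]; [apply: coord_inj|apply: coordP].
have cl k : zclosed (gt_variety K k).
  by rewrite /gt_variety; eexists => x; apply: iff_refl.
(* The required dimension computes to 1, 3 and 6. *)
by case: hn => [->|[->|->]] Z compZ;
  [apply: (gt_eqs2_has_dim (cl _) compZ (reindexing_coord _))
  |apply: (gt_eqs3_has_dim (cl _) compZ (reindexing_coord _))
  |apply: (gt_eqs4_has_dim (cl _) compZ (reindexing_coord _))] => x;
  rewrite gt_varietyE; [apply: power_sums2|apply: power_sums3|apply: power_sums4].
Qed.
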